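(* Let $k$ be a non-spherically complete complete valuation field with non-trivial valuation. Then the correspondences $V\mapsto V^{\vee}$ and $M\mapsto M^{\vee}$ (acting on morphisms by precomposition) define a $\mathrm{Mod}(O_k)$-enriched contravariant equivalence between the $\mathrm{Mod}(O_k)$-enriched category of free Banach $k$-vector spaces and contracting $k$-linear homomorphisms and the $\mathrm{Mod}(O_k)$-enriched category of cofree $O_k$-modules and $O_k$-linear homomorphisms.
   Context: A complete valuation field is a field $k$ complete with respect to a multiplicative ultrametric absolute value $|\cdot|$; $O_k=\{c\in k : |c|\le 1\}$. It is non-spherically complete if there is a sequence of closed balls in $k$ with the finite intersection property and empty intersection. $\mathrm{Mod}(O_k)$ is the symmetric monoidal category of $O_k$-modules with $\otimes_{O_k}$. A Banach $k$-vector space is a $k$-vector space complete with respect to an ultrametric norm with $\|cv\|=|c|\,\|v\|$; a $k$-linear map $f$ between Banach spaces is contracting if $\|f(v)\|\le\|v\|$ for all $v$. For a Banach $k$-vector space $V$, $V^{\vee}$ is the $O_k$-module (without topology) of contracting $k$-linear maps $V\to k$. For an $O_k$-module $M$, $M^{\vee}$ is the Banach $k$-vector space of bounded $O_k$-linear maps $M\to k$ with the supremum norm. A set $I$ is non-measurable if it is not the case that $\#I\ge\aleph_1$ and $\#I$ carries a non-principal ultrafilter closed under countable intersections. $\mathrm{C}_0(I,k)$ is the Banach space, with supremum norm, of maps $f\colon I\to k$ such that $\{i : |f(i)|\ge\epsilon\}$ is finite for every $\epsilon>0$. A Banach $k$-vector space is free if it is isometrically $k$-linearly isomorphic to $\mathrm{C}_0(I,k)$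 for some non-measurable set $I$. An $O_k$-module is cofree if it is isomorphic to the direct product $O_k^I$ for some non-measurable set $I$. *)

(* Defs.v *)
From HB Require Import structures.
From mathcomp Require Import all_boot all_order all_algebra.
From mathcomp Require Import boolp classical_sets functions cardinality filter.
From mathcomp Require Import reals ring.

Set Implicit Arguments.
Unset Strict Implicit.
Unset Printing Implicit Defensive.

Import Order.TTheory GRing.Theory Num.Theory.
Local Open Scope classical_set_scope.
Local Open Scope ring_scope.

(* [Mod(A)] with its tensor product: a morphism [hom Y Z (x) hom X Y -> hom X Z]
   is the same as an [A]-bilinear map, and a morphism [A -> hom X X] is the same
   as an element of [hom X X]. *)
Record enrichedCat (A : comNzRingType) := EnrichedCat {
  ob : Type;
  hom : ob -> ob -> lmodType A;
  idc : forall X, hom X X;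
  compc : forall X Y Z, hom Y Z -> hom X Y -> hom X Z;
  compc_linearl : forall X Y Z (f : hom X Y), linear (fun g => @compc X Y Z g f);
  compc_linearr : forall X Y Z (g : hom Y Z), linear (@compc X Y Z g);
  compc_idl : forall X Y (f : hom X Y), compc (idc Y) f = f;
  compc_idr : forall X Y (f : hom X Y), compc f (idc X) = f;
  compcA : forall X Y Z W (h : hom Z W) (g : hom Y Z) (f : hom X Y),
    compc h (compc g f) = compc (compc h g) f }.

Arguments idc {A e} X.
Arguments compc {A e X Y Z} g f.

Section EnrichedFunctors.
Variable A : comNzRingType.

Record enrichedFun (C D : enrichedCat A) := EnrichedFun {
  fun_ob : ob C -> ob D;
  fun_hom : forall X Y, hom X Y -> hom (fun_ob X) (fun_ob Y);
  fun_hom_linear : forall X Y, linear (@fun_hom X Y);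
  fun_hom_id : forall X, fun_hom (idc X) = idc (fun_ob X);
  fun_hom_comp : forall X Y Z (g : hom Y Z) (f : hom X Y),
    fun_hom (compc g f) = compc (fun_hom g) (fun_hom f) }.

Record contraFun (C D : enrichedCat A) := ContraFun {
  cfun_ob : ob C -> ob D;
  cfun_hom : forall X Y, hom X Y -> hom (cfun_ob Y) (cfun_ob X);
  cfun_hom_linear : forall X Y, linear (@cfun_hom X Y);
  cfun_hom_id : forall X, cfun_hom (idc X) = idc (cfun_ob X);
  cfun_hom_comp : forall X Y Z (g : hom Y Z) (f : hom X Y),
    cfun_hom (compc g f) = compc (cfun_hom f) (cfun_hom g) }.

Program Definition idFun (C : enrichedCat A) : enrichedFun C C :=
  @EnrichedFun C C (fun X => X) (fun X Y f => f) _ _ _.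
Next Obligation. by []. Qed.
Next Obligation. by []. Qed.
Next Obligation. by []. Qed.

Program Definition contraComp (C D E : enrichedCat A)
    (G : contraFun D E) (F : contraFun C D) : enrichedFun C E :=
  @EnrichedFun C E (fun X => cfun_ob G (cfun_ob F X))
    (fun X Y f => cfun_hom G (cfun_hom F f)) _ _ _.
Next Obligation.
by move=> C D E G F X Y a f g /=; rewrite (cfun_hom_linear F) (cfun_hom_linear G).
Qed.
Next Obligation. by move=> C D E G F X /=; rewrite (cfun_hom_id F) (cfun_hom_id G). Qed.
Next Obligation.
by move=> C D E G F X Y Z g f /=; rewrite (cfun_hom_comp F) (cfun_hom_comp G).
Qed.

Definition isomorphism (C : enrichedCat A) (X Y : ob C) (f : hom X Y) : Prop :=
  exists g : hom Y X, compc g f = idc X /\ compc f g = idc Y.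

Definition naturally_isomorphic (C D : enrichedCat A)
    (F G : enrichedFun C D) : Prop :=
  exists alpha : forall X, hom (fun_ob F X) (fun_ob G X),
    (forall X Y (f : hom X Y),
      compc (fun_hom G f) (alpha X) = compc (alpha Y) (fun_hom F f)) /\
    (forall X, isomorphism (alpha X)).

Definition contra_equivalence (C D : enrichedCat A)
    (F : contraFun C D) (G : contraFun D C) : Prop :=
  naturally_isomorphic (idFun C) (contraComp G F) /\
  naturally_isomorphic (idFun D) (contraComp F G).

Program Definition fullSubcat (C : enrichedCat A) (P : ob C -> Prop) :
    enrichedCat A :=
  @EnrichedCat A {X : ob C | P X} (fun X Y => hom (sval X) (sval Y))
    (fun X => idc (sval X)) (fun X Y Z g f => compc g f) _ _ _ _ _.
Next Obligation. by move=> C P X Y Z f; apply: compc_linearl. Qed.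
Next Obligation. by move=> C P X Y Z g; apply: compc_linearr. Qed.
Next Obligation. by move=> C P X Y f; apply: compc_idl. Qed.
Next Obligation. by move=> C P X Y f; apply: compc_idr. Qed.
Next Obligation. by move=> C P X Y Z W h g f; apply: compcA. Qed.

Program Definition contraRestrict (C D : enrichedCat A) (P : ob C -> Prop)
    (Q : ob D -> Prop) (F : contraFun C D)
    (PQ : forall X, P X -> Q (cfun_ob F X)) :
    contraFun (fullSubcat P) (fullSubcat Q) :=
  @ContraFun (fullSubcat P) (fullSubcat Q)
    (fun X => exist Q (cfun_ob F (sval X)) (PQ (sval X) (svalP X)))
    (fun X Y f => cfun_hom F f) _ _ _.
Next Obligation. by move=> C D P Q F PQ X Y a f g; exact: (cfun_hom_linear F). Qed.
Next Obligation. by move=> C D P Q F PQ X; exact: (cfun_hom_id F). Qed.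
Next Obligation. by move=> C D P Q F PQ X Y Z g f; exact: (cfun_hom_comp F). Qed.

End EnrichedFunctors.

Section ModCat.
Variable A : comNzRingType.

Definition mhom_pred (M N : lmodType A) : {pred M -> N} := fun f => `[< linear f >].

Definition mhom (M N : lmodType A) := {f : M -> N | mhom_pred f}.

Section Structure.
Variables M N : lmodType A.

Fact mhom_closed : submod_closed (@mhom_pred M N).
Proof.
split=> [|c f g /asboolP lf /asboolP lg]; apply/asboolP => a u v.
  by rewrite scaler0 addr0.
rewrite !fctE lf lg !scalerDr !scalerA mulrC -!addrA; congr (_ + _).
by rewrite addrCA.
Qed.

HB.instance Definition _ := GRing.isSubmodClosed.Build A (M -> N)
  (@mhom_pred M N) mhom_closed.
HB.instance Definition _ := Choice.on (mhom M N).
HB.instance Definition _ := SubType.on (mhom M N).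
HB.instance Definition _ := [SubChoice_isSubLmodule of mhom M N by <:].
End Structure.

Lemma mhomP (M N : lmodType A) (f : mhom M N) : linear (val f).
Proof. by case: f => f /= /asboolP. Qed.

Definition mhomS (M N : lmodType A) (f : M -> N) (lf : linear f) : mhom M N :=
  exist _ f (asboolT lf).

Lemma mhom_eqP (M N : lmodType A) (f g : mhom M N) :
  val f =1 val g -> f = g.
Proof. by move=> /funext fg; apply: val_inj. Qed.

Definition mhom_id (M : lmodType A) : mhom M M :=
  @mhomS M M idfun (fun a u v => erefl).

Fact mhom_comp_subproof (M N P : lmodType A) (g : mhom N P) (f : mhom M N) :
  linear (val g \o val f).
Proof. by move=> a u v /=; rewrite (mhomP f) (mhomP g). Qed.

Definition mhom_comp (M N P : lmodType A) (g : mhom N P) (f : mhom M N) :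
  mhom M P := mhomS (mhom_comp_subproof g f).

Program Definition modCat : enrichedCat A :=
  @EnrichedCat A (lmodType A) (fun M N => mhom M N : lmodType A)
    mhom_id mhom_comp _ _ _ _ _.
Next Obligation. by move=> M N P f a g h; apply: mhom_eqP. Qed.
Next Obligation.
move=> M N P g a f h; apply: mhom_eqP => x /=.
exact: (mhomP g).
Qed.
Next Obligation. by move=> M N f; apply: mhom_eqP. Qed.
Next Obligation. by move=> M N f; apply: mhom_eqP. Qed.
Next Obligation. by move=> M N P Q h g f; apply: mhom_eqP. Qed.

End ModCat.

Definition cauchy_complete (R : realType) (V : zmodType) (N : V -> R) : Prop :=
  forall u : nat -> V,
    (forall e : R, 0 < e -> exists n0, forall m n,
       (n0 <= m)%N -> (n0 <= n)%N -> N (u m - u n) < e) ->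
    exists l : V, forall e : R, 0 < e -> exists n0, forall n,
       (n0 <= n)%N -> N (u n - l) < e.

HB.mixin Record Field_isCompleteVal (R : realType) k of GRing.Field k := {
  absv : k -> R;
  absv_ge0 : forall x, 0 <= absv x;
  absv_eq0 : forall x, (absv x == 0) = (x == 0);
  absvM : forall x y, absv (x * y) = absv x * absv y;
  absvD_max : forall x y, absv (x + y) <= Num.max (absv x) (absv y);
  absv_complete : cauchy_complete absv }.

#[short(type="completeValFieldType")]
HB.structure Definition CompleteValField (R : realType) :=
  {k of GRing.Field k & Field_isCompleteVal R k}.

Section ValuationField.
Variables (R : realType) (k : completeValFieldType R).
Implicit Types x y : k.

Lemma absv0 : absv (0 : k) = 0.
Proof. by apply/eqP; rewrite absv_eq0. Qed.

Lemma absv1 : absv (1 : k) = 1.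
Proof.
have /eqP := absvM (1 : k) 1; rewrite mulr1 -subr_eq0 -{1}[absv 1]mulr1 -mulrBr.
rewrite mulf_eq0 absv_eq0 oner_eq0 subr_eq0 /=.
by move/eqP => <-.
Qed.

Lemma absvN x : absv (- x) = absv x.
Proof.
suff h : absv (-1 : k) = 1 by rewrite -mulN1r absvM h mul1r.
have /eqP : absv (-1 : k) ^+ 2 = 1 by rewrite expr2 -absvM mulrNN mulr1 absv1.
by rewrite sqrf_eq1 => /orP[/eqP//|/eqP h]; have := absv_ge0 (-1 : k); rewrite h oppr_ge0 ler10.
Qed.

Definition nontrivially_valued : Prop := exists c : k, c != 0 /\ absv c <> 1.

(* Allowing the radius 0 would not change the next notion: a singleton in a
   family with the finite intersection property meets every other member. *)
Definition is_closed_ball (B : set k) : Prop :=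
  exists (c : k) (r : R), 0 < r /\ B = [set x | absv (x - c) <= r].

Definition non_spherically_complete : Prop :=
  exists B : nat -> set k,
    [/\ forall n, is_closed_ball (B n),
        finI [set: nat] B &
        \bigcap_n B n = set0].

Definition vint_pred : {pred k} := fun c => absv c <= 1.

Fact vint_closed : subring_closed vint_pred.
Proof.
split=> [|x y|x y]; rewrite !unfold_in.
- by rewrite absv1.
- by move=> x1 y1; rewrite (le_trans (absvD_max _ _))// absvN ge_max x1.
- by move=> x1 y1; rewrite absvM mulr_ile1 ?absv_ge0.
Qed.

HB.instance Definition _ := GRing.isSubringClosed.Build k vint_pred vint_closed.

Definition vint := {c : k | vint_pred c}.
HB.instance Definition _ := Choice.on vint.
HB.instance Definition _ := SubType.on vint.
HB.instance Definition _ := [SubChoice_isSubComNzRing of vint by <:].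

End ValuationField.

Arguments nontrivially_valued {R} k.
Arguments non_spherically_complete {R} k.
Arguments vint {R} k.

HB.mixin Record Lmodule_isBanach (R : realType) (k : completeValFieldType R) V
    of GRing.Lmodule k V := {
  bnorm : V -> R;
  bnorm_ge0 : forall v, 0 <= bnorm v;
  bnorm_eq0 : forall v, (bnorm v == 0) = (v == 0);
  bnormZ : forall c v, bnorm (c *: v) = absv c * bnorm v;
  bnormD_max : forall v w, bnorm (v + w) <= Num.max (bnorm v) (bnorm w);
  bnorm_complete : cauchy_complete bnorm }.

#[short(type="banachType")]
HB.structure Definition Banach (R : realType) (k : completeValFieldType R) :=
  {V of GRing.Lmodule k V & Lmodule_isBanach R k V}.

HB.instance Definition _ (R : realType) (k : completeValFieldType R) :=
  Lmodule_isBanach.Build R k (k^o) (@absv_ge0 R k) (@absv_eq0 R k)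
    (@absvM R k) (@absvD_max R k) (@absv_complete R k).

Section Contr.
Variables (R : realType) (k : completeValFieldType R).

Definition contr_pred (V W : banachType k) : {pred V -> W} :=
  fun f => `[< linear f /\ forall v, bnorm (f v) <= bnorm v >].

Definition contr (V W : banachType k) := {f : V -> W | contr_pred f}.

Section Structure.
Variables V W : banachType k.

Fact bnorm0 : bnorm (0 : W) = 0.
Proof. by apply/eqP; rewrite bnorm_eq0. Qed.

Fact bnormN (w : W) : bnorm (- w) = bnorm w.
Proof. by rewrite -scaleN1r bnormZ absvN absv1 mul1r. Qed.

Fact contr_closed : zmod_closed (@contr_pred V W).
Proof.
split=> [|f g /asboolP[lf cf] /asboolP[lg cg]]; apply/asboolP; split.
- by move=> a u v; rewrite scaler0 addr0.
- by move=> v; rewrite bnorm0 bnorm_ge0.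
- by move=> a u v; rewrite !fctE lf lg scalerBr opprD addrACA.
- by move=> v; rewrite (le_trans (bnormD_max _ _))// bnormN ge_max cf cg.
Qed.

HB.instance Definition _ := GRing.isZmodClosed.Build (V -> W)
  (@contr_pred V W) contr_closed.
HB.instance Definition _ := Choice.on (contr V W).
HB.instance Definition _ := SubType.on (contr V W).
HB.instance Definition _ := [SubChoice_isSubZmodule of contr V W by <:].

Lemma contr_linear (f : contr V W) : linear (val f).
Proof. by case: f => f /= /asboolP[]. Qed.

Lemma contr_le (f : contr V W) v : bnorm (val f v) <= bnorm v.
Proof. by case: f => f /= /asboolP[]. Qed.

Lemma contr_eqP (f g : contr V W) : val f =1 val g -> f = g.
Proof. by move=> /funext fg; apply: val_inj. Qed.

Definition contrS (f : V -> W) (lf : linear f)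
    (cf : forall v, bnorm (f v) <= bnorm v) : contr V W :=
  exist _ f (asboolT (conj lf cf)).

Fact contr_scale_linear (c : vint k) (f : contr V W) :
  linear (fun v => val c *: val f v).
Proof.
by move=> a u v; rewrite contr_linear scalerDr !scalerA mulrC.
Qed.

Fact contr_scale_le (c : vint k) (f : contr V W) v :
  bnorm (val c *: val f v) <= bnorm v.
Proof.
rewrite bnormZ (le_trans _ (contr_le f v))// ler_piMl ?bnorm_ge0//.
exact: (valP c).
Qed.

Definition contr_scale (c : vint k) (f : contr V W) : contr V W :=
  contrS (contr_scale_linear c f) (@contr_scale_le c f).

Program Definition contr_lmodMixin :=
  @GRing.Zmodule_isLmodule.Build (vint k) (contr V W) contr_scale _ _ _ _.
Next Obligation. by move=> a b f; apply: contr_eqP => v /=; rewrite scalerA. Qed.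
Next Obligation. by move=> f; apply: contr_eqP => v /=; rewrite scale1r. Qed.
Next Obligation. by move=> c f g; apply: contr_eqP => v /=; rewrite scalerDr. Qed.
Next Obligation. by move=> f a b; apply: contr_eqP => v /=; rewrite scalerDl. Qed.
HB.instance Definition _ := contr_lmodMixin.

End Structure.

Definition contr_id (V : banachType k) : contr V V :=
  @contrS V V idfun (fun a u v => erefl) (fun v => lexx _).

Section Comp.
Variables (V W X : banachType k) (g : contr W X) (f : contr V W).

Fact contr_comp_linear : linear (val g \o val f).
Proof. by move=> a u v /=; rewrite !contr_linear. Qed.

Fact contr_comp_le v : bnorm ((val g \o val f) v) <= bnorm v.
Proof. exact: le_trans (contr_le _ _) (contr_le _ _). Qed.

Definition contr_comp : contr V X := contrS contr_comp_linear contr_comp_le.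
End Comp.

Program Definition banCat : enrichedCat (vint k) :=
  @EnrichedCat (vint k) (banachType k) (fun V W => contr V W : lmodType (vint k))
    contr_id contr_comp _ _ _ _ _.
Next Obligation. by move=> U V W f a g h; apply: contr_eqP. Qed.
Next Obligation.
by move=> U V W g a f h; apply: contr_eqP => x /=; rewrite contr_linear.
Qed.
Next Obligation. by move=> V W f; apply: contr_eqP. Qed.
Next Obligation. by move=> V W f; apply: contr_eqP. Qed.
Next Obligation. by move=> V W X Y h g f; apply: contr_eqP. Qed.

(* The [O_k]-module of contracting [k]-linear maps into the Banach space [k]. *)
Definition dualB (V : banachType k) : lmodType (vint k) := contr V k^o.

Section DualBMap.
Variables (V W : banachType k) (f : contr V W).

Fact dualB_map_linear : linear (fun g : dualB W => contr_comp g f : dualB V).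
Proof. by move=> a g h; apply: contr_eqP. Qed.

Definition dualB_map : mhom (dualB W) (dualB V) := mhomS dualB_map_linear.
End DualBMap.

Program Definition dualBFun : contraFun banCat (modCat (vint k)) :=
  @ContraFun _ banCat (modCat (vint k)) dualB dualB_map _ _ _.
Next Obligation.
move=> V W a f g; apply: mhom_eqP => h; apply: contr_eqP => v /=.
exact: (contr_linear h).
Qed.
Next Obligation. by move=> V; apply: mhom_eqP => h; apply: contr_eqP. Qed.
Next Obligation. by move=> U V W g f; apply: mhom_eqP => h; apply: contr_eqP. Qed.

End Contr.

Section SupNorm.
Variables (R : realType) (k : completeValFieldType R) (X : Type).
Implicit Types f g : X -> k^o.

Definition bounded_map f : Prop := exists C : R, forall x, absv (f x) <= C.

(* On an empty [X] this is [sup set0 = 0]. *)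
Definition supnorm f : R := sup (range (fun x => absv (f x))).

Lemma supnorm_ub f x : bounded_map f -> absv (f x) <= supnorm f.
Proof.
move=> [C fC]; apply: ub_le_sup; last by exists x.
by exists C => _ [y _ <-].
Qed.

Lemma supnorm_le f C : 0 <= C -> (forall x, absv (f x) <= C) -> supnorm f <= C.
Proof.
move=> C0 fC; have [r0|/set0P ne] := eqVneq (range (fun x => absv (f x))) set0.
  by rewrite /supnorm r0 sup0.
by apply: ge_sup => // _ [x _ <-].
Qed.

Lemma supnorm_ge0 f : bounded_map f -> 0 <= supnorm f.
Proof.
move=> bf; have [r0|/set0P[_ [x _ _]]] :=
  eqVneq (range (fun x => absv (f x))) set0; first by rewrite /supnorm r0 sup0.
exact: le_trans (absv_ge0 _) (supnorm_ub x bf).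
Qed.

Lemma supnorm_eq0 f : bounded_map f -> (supnorm f == 0) = (f == 0).
Proof.
move=> bf; apply/eqP/eqP => [f0|->].
  apply/funext => x; apply/eqP; rewrite -[_ == _]absv_eq0.
  by rewrite eq_le absv_ge0 -f0 supnorm_ub.
apply/eqP; rewrite eq_le supnorm_ge0 ?andbT; last first.
  by exists 0 => x; rewrite absv0.
by apply: supnorm_le => // x; rewrite absv0.
Qed.

Lemma supnormZ c f : bounded_map f -> supnorm (c *: f) = absv c * supnorm f.
Proof.
move=> bf; have bcf : bounded_map (c *: f).
  by case: bf => C fC; exists (absv c * C) => x; rewrite absvM ler_wpM2l ?absv_ge0.
apply/eqP; rewrite eq_le; apply/andP; split.
  apply: supnorm_le => [|x]; first by rewrite mulr_ge0 ?absv_ge0 ?supnorm_ge0.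
  by rewrite absvM ler_wpM2l ?absv_ge0 ?supnorm_ub.
have [->|c0] := eqVneq c 0; first by rewrite absv0 mul0r supnorm_ge0// scale0r; exists 0 => x; rewrite absv0.
have ac : 0 < absv c by rewrite lt_neqAle absv_ge0 andbT eq_sym absv_eq0.
rewrite mulrC -ler_pdivlMr//; apply: supnorm_le => [|x].
  by rewrite divr_ge0 ?supnorm_ge0 ?absv_ge0.
by rewrite ler_pdivlMr// mulrC -absvM; exact: (supnorm_ub x bcf).
Qed.

Lemma supnormD_max f g : bounded_map f -> bounded_map g ->
  supnorm (f + g) <= Num.max (supnorm f) (supnorm g).
Proof.
move=> bf bg; apply: supnorm_le => [|x].
  by rewrite le_max supnorm_ge0.
rewrite (le_trans (absvD_max _ _))// ge_max !le_max.
by rewrite (supnorm_ub x bf) (supnorm_ub x bg) orbT.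
Qed.

Lemma supnorm_complete (P : (X -> k^o) -> Prop) (u : nat -> X -> k^o) :
  (forall f, P f -> bounded_map f) ->
  (forall f, (forall e : R, 0 < e ->
     exists2 g, P g & forall x, absv (f x - g x) < e) -> P f) ->
  (forall n, P (u n)) ->
  (forall m n, P (u m - u n)) ->
  (forall e : R, 0 < e -> exists n0, forall m n,
    (n0 <= m)%N -> (n0 <= n)%N -> supnorm (u m - u n) < e) ->
  exists2 l, P l & forall e : R, 0 < e -> exists n0, forall n, (n0 <= n)%N ->
    (forall x, absv (u n x - l x) <= e).
Proof.
move=> Pb Pc Pu PB uC.
have pt x : exists l : k, forall e : R, 0 < e -> exists n0, forall n,
       (n0 <= n)%N -> absv (u n x - l) < e.
  apply: absv_complete => e e0; have [n0 n0P] := uC _ e0.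
  exists n0 => m n m0 n0'; apply: le_lt_trans (n0P _ _ m0 n0').
  exact: (supnorm_ub x (Pb _ (PB m n))).
have [l lP] := choice pt.
have cv : forall e : R, 0 < e -> exists n0, forall n, (n0 <= n)%N ->
    (forall x, absv (u n x - l x) <= e).
  move=> e e0; have [n0 n0P] := uC _ e0; exists n0 => n n0n x.
  have [n1 n1P] := lP x _ e0.
  have -> : u n x - l x = (u n x - u (maxn n0 n1) x) + (u (maxn n0 n1) x - l x).
    by rewrite addrA subrK.
  rewrite (le_trans (absvD_max _ _))// ge_max; apply/andP; split.
    apply: le_trans (ltW (n0P n (maxn n0 n1) n0n (leq_maxl _ _))).
    exact: (supnorm_ub x (Pb _ (PB _ _))).
  by rewrite ltW// n1P// leq_maxr.
exists l => //; apply: Pc => e e0.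
have e20 : 0 < e / 2 by rewrite divr_gt0.
have [n0 n0P] := cv _ e20; exists (u n0) => // x.
rewrite -absvN opprB (le_lt_trans (n0P n0 (leqnn _) x))//.
by rewrite ltr_pdivrMr// ltr_pMr// ltr1n.
Qed.

End SupNorm.

Section NullFamilies.
Variables (R : realType) (k : completeValFieldType R) (I : Type).

Definition C0_pred : {pred I -> k^o} :=
  fun f => `[< forall e : R, 0 < e -> finite_set [set i | e <= absv (f i)] >].

Definition C0 := {f : I -> k^o | C0_pred f}.

Fact C0_closed : submod_closed C0_pred.
Proof.
split=> [|c f g /asboolP f0 /asboolP g0]; apply/asboolP => e e0.
  rewrite (_ : [set _ | _] = set0)//.
  by apply/seteqP; split => // i /=; rewrite absv0 leNgt e0.
have c1 : 0 < 1 + absv c by rewrite ltr_wpDr ?absv_ge0.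
apply: (@sub_finite_set _ _ ([set i | e / (1 + absv c) <= absv (f i)] `|`
    [set i | e <= absv (g i)])).
  move=> i /= /le_trans/(_ (absvD_max _ _)); rewrite le_max => /orP[h|h].
    left; rewrite ler_pdivrMr// (le_trans h)// absvM mulrC.
    by rewrite ler_wpM2l ?absv_ge0// lerDr.
  by right.
by rewrite finite_setU; split; [apply: f0; rewrite divr_gt0|apply: g0].
Qed.

HB.instance Definition _ := GRing.isSubmodClosed.Build k (I -> k^o)
  C0_pred C0_closed.
HB.instance Definition _ := Choice.on C0.
HB.instance Definition _ := SubType.on C0.
HB.instance Definition _ := [SubChoice_isSubLmodule of C0 by <:].

Lemma C0P (f : C0) (e : R) : 0 < e -> finite_set [set i | e <= absv (val f i)].
Proof. by case: f => f /= /asboolP; apply. Qed.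

Lemma C0_pred_bounded (f : I -> k^o) : C0_pred f -> bounded_map f.
Proof.
move=> /asboolP/(_ 1 ltr01).
set S := [set i | _] => finS.
have /finite_seqP[s sE] : finite_set ((fun i => absv (f i)) @` S).
  exact: finite_image.
exists (\big[Num.max/1]_(r <- s) r) => i.
have [h|/ltW h] := leP 1 (absv (f i)); last first.
  by rewrite (le_trans h)// bigmax_ge_id.
have : ((fun i => absv (f i)) @` S) (absv (f i)) by exists i.
rewrite sE /=; elim: (s) => //= r t IH; rewrite big_cons inE le_max.
by move=> /predU1P[->|/IH ->]; rewrite ?lexx ?orbT.
Qed.

Lemma C0_bounded (f : C0) : bounded_map (val f).
Proof. by apply: C0_pred_bounded; apply: valP. Qed.

Lemma C0_pred_closed (f : I -> k^o) :
  (forall e : R, 0 < e -> exists2 g, C0_pred g & forall i, absv (f i - g i) < e) ->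
  C0_pred f.
Proof.
move=> fP; apply/asboolP => e e0; have [g /asboolP/(_ _ e0) gP fg] := fP _ e0.
apply: sub_finite_set gP => i /= ei.
rewrite leNgt; apply/negP => gi.
have := absvD_max (f i - g i) (g i); rewrite subrK leNgt => /negP; apply.
by rewrite gt_max !(lt_le_trans _ ei).
Qed.

Definition C0_norm (f : C0) : R := supnorm (val f).

Fact C0_norm_ge0 f : 0 <= C0_norm f.
Proof. exact/supnorm_ge0/C0_bounded. Qed.

Fact C0_norm_eq0 f : (C0_norm f == 0) = (f == 0).
Proof. by rewrite /C0_norm supnorm_eq0 //; exact: C0_bounded. Qed.

Fact C0_normZ c f : C0_norm (c *: f) = absv c * C0_norm f.
Proof. exact/supnormZ/C0_bounded. Qed.

Fact C0_normD_max f g : C0_norm (f + g) <= Num.max (C0_norm f) (C0_norm g).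
Proof. by apply: supnormD_max; exact: C0_bounded. Qed.

Fact C0_norm_complete : cauchy_complete C0_norm.
Proof.
move=> u uC.
have [l Pl lP] := supnorm_complete C0_pred_bounded C0_pred_closed
  (fun n => valP (u n)) (fun m n => valP (u m - u n)) uC.
exists (exist _ l Pl) => e e0.
have e20 : 0 < e / 2 by rewrite divr_gt0.
have [n0 n0P] := lP _ e20; exists n0 => n n0n.
apply: (@le_lt_trans _ _ (e / 2)); last by rewrite ltr_pdivrMr// ltr_pMr// ltr1n.
by apply: supnorm_le; [exact: ltW|exact: n0P].
Qed.

HB.instance Definition _ := Lmodule_isBanach.Build R k C0
  C0_norm_ge0 C0_norm_eq0 C0_normZ C0_normD_max C0_norm_complete.

End NullFamilies.

Section DualM.
Variables (R : realType) (k : completeValFieldType R).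

Section Structure.
Variable M : lmodType (vint k).

(* [O_k]-linearity of a map into [k], the ring [O_k] acting on [k] through the
   inclusion. *)
Definition vint_linear (f : M -> k^o) : Prop :=
  forall (c : vint k) (m n : M), f (c *: m + n) = val c * f m + f n.

Definition dualM_pred : {pred M -> k^o} :=
  fun f => `[< vint_linear f /\ bounded_map f >].

Definition dualM := {f : M -> k^o | dualM_pred f}.

Fact dualM_closed : submod_closed dualM_pred.
Proof.
split=> [|c f g /asboolP[lf [C fC]] /asboolP[lg [D gD]]]; apply/asboolP; split.
- by move=> c m n; rewrite mulr0 addr0.
- by exists 0 => m; rewrite absv0.
- move=> a m n; rewrite !fctE lf lg !scalerDr mulrDr addrACA; congr (_ + _ + _).
  by rewrite [LHS]mulrCA.
- exists (Num.max (absv c * C) D) => m; rewrite (le_trans (absvD_max _ _))//.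
  by rewrite ge_max !le_max gD orbT absvM ler_wpM2l ?absv_ge0.
Qed.

HB.instance Definition _ := GRing.isSubmodClosed.Build k (M -> k^o)
  dualM_pred dualM_closed.
HB.instance Definition _ := Choice.on dualM.
HB.instance Definition _ := SubType.on dualM.
HB.instance Definition _ := [SubChoice_isSubLmodule of dualM by <:].

Lemma dualM_linear (f : dualM) : vint_linear (val f).
Proof. by case: f => f /= /asboolP[]. Qed.

Lemma dualM_bounded (f : dualM) : bounded_map (val f).
Proof. by case: f => f /= /asboolP[]. Qed.

Lemma dualM_eqP (f g : dualM) : val f =1 val g -> f = g.
Proof. by move=> /funext fg; apply: val_inj. Qed.

Definition dualMS (f : M -> k^o) (lf : vint_linear f) (bf : bounded_map f) :
  dualM := exist _ f (asboolT (conj lf bf)).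

Lemma dualM_pred_closed (f : M -> k^o) :
  (forall e : R, 0 < e -> exists2 g, dualM_pred g & forall m, absv (f m - g m) < e) ->
  dualM_pred f.
Proof.
move=> fP; apply/asboolP; split; last first.
  have [g /asboolP[_ [C gC]] fg] := fP _ ltr01.
  exists (Num.max 1 C) => m; rewrite -(subrK (g m) (f m)).
  by rewrite (le_trans (absvD_max _ _))// ge_max !le_max gC orbT (ltW (fg m)).
move=> c m n; apply/eqP; rewrite -subr_eq0 -absv_eq0 eq_le absv_ge0 andbT.
apply/ler_addgt0Pr => e e0; rewrite add0r; apply: ltW.
have [g /asboolP[lg _] fg] := fP _ e0.
have -> : f (c *: m + n) - (val c * f m + f n) =
    (f (c *: m + n) - g (c *: m + n)) +
      (val c * (g m - f m) + (g n - f n)).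
  by rewrite lg mulrBr; ring.
have gf p : absv (g p - f p) < e by rewrite -absvN opprB.
rewrite (le_lt_trans (absvD_max _ _))// gt_max fg /=.
rewrite (le_lt_trans (absvD_max _ _))// gt_max gf andbT absvM.
rewrite (le_lt_trans _ (gf m))// ler_piMl ?absv_ge0//.
exact: (valP c).
Qed.

Definition dualM_norm (f : dualM) : R := supnorm (val f).

Fact dualM_norm_ge0 f : 0 <= dualM_norm f.
Proof. exact/supnorm_ge0/dualM_bounded. Qed.

Fact dualM_norm_eq0 f : (dualM_norm f == 0) = (f == 0).
Proof. by rewrite /dualM_norm supnorm_eq0 //; exact: dualM_bounded. Qed.

Fact dualM_normZ c f : dualM_norm (c *: f) = absv c * dualM_norm f.
Proof. exact/supnormZ/dualM_bounded. Qed.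

Fact dualM_normD_max f g :
  dualM_norm (f + g) <= Num.max (dualM_norm f) (dualM_norm g).
Proof. by apply: supnormD_max; exact: dualM_bounded. Qed.

Fact dualM_norm_complete : cauchy_complete dualM_norm.
Proof.
move=> u uC.
have Pb f : dualM_pred f -> bounded_map f by case/asboolP.
have [l Pl lP] := supnorm_complete Pb dualM_pred_closed
  (fun n => valP (u n)) (fun m n => valP (u m - u n)) uC.
exists (exist _ l Pl) => e e0.
have e20 : 0 < e / 2 by rewrite divr_gt0.
have [n0 n0P] := lP _ e20; exists n0 => n n0n.
apply: (@le_lt_trans _ _ (e / 2)); last by rewrite ltr_pdivrMr// ltr_pMr// ltr1n.
by apply: supnorm_le; [exact: ltW|exact: n0P].
Qed.

HB.instance Definition _ := Lmodule_isBanach.Build R k dualM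
  dualM_norm_ge0 dualM_norm_eq0 dualM_normZ dualM_normD_max dualM_norm_complete.

End Structure.

Section Map.
Variables (M N : lmodType (vint k)) (f : mhom M N).

Fact dualM_precomp_linear (g : dualM N) : vint_linear (val g \o val f).
Proof. by move=> c m n /=; rewrite (mhomP f) dualM_linear. Qed.

Fact dualM_precomp_bounded (g : dualM N) : bounded_map (val g \o val f).
Proof. by have [C gC] := dualM_bounded g; exists C => m; apply: gC. Qed.

Definition dualM_precomp (g : dualM N) : dualM M :=
  dualMS (dualM_precomp_linear g) (dualM_precomp_bounded g).

Fact dualM_map_linear : linear dualM_precomp.
Proof. by move=> a g h; apply: dualM_eqP. Qed.

Fact dualM_map_le (g : dualM N) : bnorm (dualM_precomp g) <= bnorm g.
Proof.
apply: supnorm_le => [|m]; first exact: dualM_norm_ge0.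
exact: (supnorm_ub (val f m) (dualM_bounded g)).
Qed.

Definition dualM_map : contr (dualM N) (dualM M) :=
  contrS dualM_map_linear dualM_map_le.
End Map.

Program Definition dualMFun : contraFun (modCat (vint k)) (banCat k) :=
  @ContraFun _ (modCat (vint k)) (banCat k) (fun M => dualM M : banachType k)
    dualM_map _ _ _.
Next Obligation.
move=> M N a f g; apply: contr_eqP => h; apply: dualM_eqP => m /=.
exact: (dualM_linear h).
Qed.
Next Obligation. by move=> M; apply: contr_eqP => h; apply: dualM_eqP. Qed.
Next Obligation.
by move=> M N P g f; apply: contr_eqP => h; apply: dualM_eqP.
Qed.

End DualM.

Definition nonprincipal (I : Type) (U : set_system I) : Prop :=
  forall i, U <> principal_filter i.

(* [aleph_1] is the least uncountable cardinal, so [#I >= aleph_1] says that [I]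
   is uncountable. *)
Definition measurable_card (I : Type) : Prop :=
  ~ countable [set: I] /\
  exists U : set_system I,
    [/\ UltraFilter U, nonprincipal U &
        forall B : nat -> set I, (forall n, U (B n)) -> U (\bigcap_n B n)].

Definition free_banach (R : realType) (k : completeValFieldType R)
    (V : banachType k) : Prop :=
  exists I : Type, ~ measurable_card I /\
    exists phi : V -> C0 k I,
      [/\ linear phi, bijective phi & forall v, bnorm (phi v) = bnorm v].

Definition cofree (R : realType) (k : completeValFieldType R)
    (M : lmodType (vint k)) : Prop :=
  exists I : Type, ~ measurable_card I /\
    exists phi : M -> (I -> (vint k)^o), linear phi /\ bijective phi.

(* Main.v *)
Require Import Defs.
From mathcomp Require Import all_boot all_order all_algebra.
From mathcomp Require Import finmap.
From mathcomp Require Import boolp classical_sets functions cardinality filter.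
From mathcomp Require Import reals ring lra.

(** Both duals are computed by a single pairing. If [c] is a null family in [k]
    and [a] a family in [O_k], both indexed by [I], then the sum [dot c a] of the
    products converges, since in a complete ultrametric field every null family
    is summable. A contracting functional on [C0 k I] is determined by its values
    at the unit vectors, so the dual of [C0 k I] is the product [O_k^I]
    ([contr_C0E]). Conversely the dual of [O_k^I] is [C0 k I] when [I] is not
    measurable and [k] is not spherically complete ([functionalE]): every bounded
    [O_k]-linear map from [O_k^I] to [k] is [dot c] for some [c]. Granted this,
    the evaluation maps from [V] and [M] to their double duals are isomorphisms
    for [V] free and [M] cofree, and they are natural by construction.

    The proof of [functionalE] has three steps.

    First, a bounded functional [g] on integral sequences that kills all [delta n]
    is 0 ([functional_seq_eq0]). Modulo finitely supported sequences, any sequence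
    of corrections of decreasing size can be summed, so the bounded sequences
    modulo the finitely supported ones are spherically complete. A nonzero [g]
    would transport this to [k].

    Second, the coefficients [Phi (delta i)] of any bounded functional form a null
    family ([delta_null]). Otherwise one gets a functional on integral sequences
    with the same nonzero value at all [delta n], and comparing it with its
    composite with the shift contradicts the first step
    ([deltas_not_bounded_below]).

    Third, after subtracting the pairing with the coefficients one may assume that
    [Phi] kills all [delta i]. If [Phi a] is not 0, then sending [B] to the value of
    [Phi] at the restriction of [a] to [B] is a measure with values in [k] which
    vanishes on points, is countably additive, and tends to 0 along disjoint sets
    by the first two steps. The sets all of whose subsets have measure at most
    half of [absv (Phi a)] form a countably complete ideal, and no infinite
    disjoint family lies outside it. Such an ideal has an atom, and the sets
    containing the atom up to the ideal form a countably complete non-principal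
    ultrafilter, so that [I] is measurable ([measurable_card_of_functional]). *)

Set Implicit Arguments.
Unset Strict Implicit.
Unset Printing Implicit Defensive.

Import Order.TTheory GRing.Theory Num.Theory.
Local Open Scope classical_set_scope.
Local Open Scope ring_scope.

(** * Ultrametric estimates *)

Section Ultrametric.
Variables (R : realType) (k : completeValFieldType R).
Implicit Types (x y : k) (C : R).

Lemma absv_gt0 x : (0 < absv x) = (x != 0).
Proof. by rewrite lt_def absv_eq0 absv_ge0 andbT. Qed.

Lemma absvV x : absv x^-1 = (absv x)^-1.
Proof.
have [->|x0] := eqVneq x 0; first by rewrite invr0 absv0 invr0.
have ax0 : absv x != 0 by rewrite absv_eq0.
by apply: (mulfI ax0); rewrite -absvM !divff// absv1.
Qed.

Lemma absvBC x y : absv (x - y) = absv (y - x).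
Proof. by rewrite -absvN opprB. Qed.

Lemma absvD_le x y C : absv x <= C -> absv y <= C -> absv (x + y) <= C.
Proof. by move=> xC yC; rewrite (le_trans (absvD_max _ _))// ge_max xC. Qed.

Lemma absvB_le x y C : absv x <= C -> absv y <= C -> absv (x - y) <= C.
Proof. by move=> xC yC; apply: absvD_le; rewrite ?absvN. Qed.

Lemma absv_sum_le (I : eqType) (s : seq I) (P : pred I) (F : I -> k) C : 0 <= C ->
  (forall i, i \in s -> P i -> absv (F i) <= C) ->
  absv (\sum_(i <- s | P i) F i) <= C.
Proof.
move=> C0 FC; rewrite big_seq_cond; elim/big_ind: _ => [|x y|i /andP[]].
- by rewrite absv0.
- exact: absvD_le.
- exact: FC.
Qed.

Lemma exists_small (e : R) : 0 < e -> exists n, (n.+1%:R)^-1 <= e.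
Proof.
move=> e0; exists (Num.bound e^-1); rewrite invf_ple ?posrE ?ltr0n//.
apply/ltW/(lt_le_trans (archi_boundP _)); first by rewrite invr_ge0 ltW.
by rewrite ler_nat.
Qed.

(** Elements of [k] are turned into integers without carrying proofs: outside
    the unit ball the value is the junk value 0. *)
Definition to_vint x : vint k := insubd 0 x.

Lemma val_to_vint x : absv x <= 1 -> val (to_vint x) = x.
Proof. by move=> x1; rewrite /to_vint val_insubd ifT. Qed.

Lemma absv_vint (c : vint k) : absv (val c) <= 1.
Proof. exact: (valP c). Qed.

Lemma absv_vint_sum_le (I : eqType) (s : seq I) (P : pred I)
    (F : I -> (vint k)^o) C : 0 <= C ->
  (forall i, i \in s -> P i -> absv (val (F i)) <= C) ->
  absv (val (\sum_(i <- s | P i) F i)) <= C.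
Proof.
move=> C0 FC; rewrite big_seq_cond.
elim/big_ind: _ => [|x y|i /andP[]]; [by rewrite absv0|exact: absvD_le|exact: FC].
Qed.

End Ultrametric.

(** * Sums of null families *)

Section Summation.
Variables (R : realType) (k : completeValFieldType R) (I : choiceType).
Implicit Types (f g : I -> k^o) (s t : k) (C : R).

(** Unconditional convergence along the finite subsets of [I]. With the large
    inequality the bound of [has_sum_le] passes to the limit, and over a
    discrete index set no order of summation has to be chosen. *)
Definition has_sum f s := forall e : R, 0 < e -> exists S : {fset I},
  forall T : {fset I}, (S `<=` T)%fset -> absv (s - \sum_(i <- T) f i) <= e.

Lemma has_sum_unique f s t : has_sum f s -> has_sum f t -> s = t.
Proof.
move=> fs ft; apply/eqP; rewrite -subr_eq0 -absv_eq0 eq_le absv_ge0 andbT.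
apply/ler_addgt0Pr => e e0; rewrite add0r.
have [S SP] := fs e e0; have [T TP] := ft e e0.
have -> : s - t = (s - \sum_(i <- (S `|` T)%fset) f i) -
    (t - \sum_(i <- (S `|` T)%fset) f i).
  by ring.
by apply: absvB_le; [apply: SP; exact: fsubsetUl|apply: TP; exact: fsubsetUr].
Qed.

Lemma has_sumD f g s t : has_sum f s -> has_sum g t -> has_sum (f + g) (s + t).
Proof.
move=> fs gt e e0; have [S SP] := fs e e0; have [T TP] := gt e e0.
exists (S `|` T)%fset => U; rewrite fsubUset => /andP[SU TU].
rewrite big_split opprD addrACA.
by apply: absvD_le; [exact: SP|exact: TP].
Qed.

Lemma has_sumZ c f s : has_sum f s -> has_sum (c *: f) (c * s).
Proof.
move=> fs e e0.
have [->|c0] := eqVneq c 0.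
  exists fset0 => U _; rewrite mul0r sub0r absvN.
  by rewrite big1 ?absv0 ?ltW// => i _; rewrite scale0r.
have ac : 0 < absv c by rewrite absv_gt0.
have [S SP] := fs (e / absv c) (divr_gt0 e0 ac).
exists S => U /SP; rewrite -mulr_sumr -mulrBr absvM.
by rewrite ler_pdivlMr// mulrC.
Qed.

Lemma has_sum_le f s C : 0 <= C -> (forall i, absv (f i) <= C) ->
  has_sum f s -> absv s <= C.
Proof.
move=> C0 fC fs; apply/ler_addgt0Pr => e e0.
have [S SP] := fs e e0.
rewrite -(subrK (\sum_(i <- S) f i) s).
apply: absvD_le; first by rewrite (le_trans (SP S _))// lerDr.
by apply: (@le_trans _ _ C); [exact: absv_sum_le|rewrite lerDl ltW].
Qed.

Lemma has_sum1 f i : (forall j, j != i -> f j = 0) -> has_sum f (f i).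
Proof.
move=> fi e e0; exists [fset i]%fset => T; rewrite fsub1set => iT.
rewrite (big_fsetD1 i)//= big1_seq ?addr0 ?subrr ?absv0 ?ltW//.
by move=> j /=; rewrite !inE => /andP[ji _]; rewrite fi.
Qed.

(** The terms outside [S n], the finite set of indices with a term of absolute
    value at least [1/(n+1)], are smaller than [1/(n+1)]; by the ultrametric
    inequality so is any finite sum of them, whatever the number of terms. Hence
    the sums over the sets [S n] form a Cauchy sequence, and its limit is the sum
    of the family. *)
Lemma has_sum_exists (c : C0 k I) : exists s, has_sum (val c) s.
Proof.
pose S n := fset_set [set i | (n.+1%:R)^-1 <= absv (val c i)].
have SE n i : (i \notin S n) = (absv (val c i) < (n.+1%:R)^-1).
  rewrite in_fset_set; last by apply: C0P; rewrite invr_gt0 ltr0n.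
  by rewrite ltNge; congr negb; apply/idP/idP; rewrite inE.
have sub n (T : {fset I}) : (S n `<=` T)%fset ->
    absv (\sum_(i <- T) val c i - \sum_(i <- S n) val c i) <= (n.+1%:R)^-1.
  move=> ST; rewrite (big_fsetID _ (mem (S n)) T) /=.
  have -> : [fset x in T | x \in S n]%fset = S n.
    apply/fsetP => x; rewrite !inE /=; apply/andP/idP => [[]//|xS].
    by split=> //; exact: (fsubsetP ST).
  rewrite addrAC subrr add0r; apply: absv_sum_le.
    by rewrite invr_ge0 ler0n.
  by move=> i; rewrite !inE => /andP[_]; rewrite SE => /ltW.
have mono m n : (m <= n)%N -> (S m `<=` S n)%fset.
  move=> mn; apply/fsubsetP => i; apply: contraLR; rewrite !SE => /lt_le_trans; apply.
  by rewrite lef_pV2 ?posrE ?ltr0n// ler_nat.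
have [|s sP] := @absv_complete R k (fun n => \sum_(i <- S n) val c i).
  move=> e e0; have [n nP] : exists n, (n.+1%:R)^-1 <= e / 2.
    by apply: exists_small; rewrite divr_gt0.
  exists n => p q np nq; apply: (@le_lt_trans _ _ (e / 2)); last first.
    by rewrite ltr_pdivrMr// ltr_pMr// ltr1n.
  apply: le_trans nP.
  rewrite -(subrKA (\sum_(i <- S n) val c i)); apply: absvD_le.
    exact/sub/mono.
  by rewrite absvBC; exact/sub/mono.
exists s => e e0; have [n nP] := exists_small e0; have [m mP] := sP e e0.
have := mP (maxn n m) (leq_maxr _ _); rewrite absvBC => /ltW sS.
exists (S (maxn n m)) => T ST.
rewrite -(subrKA (\sum_(i <- S (maxn n m)) val c i)); apply: absvD_le => //.
rewrite absvBC (le_trans (sub _ _ ST))// (le_trans _ nP)//.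
by rewrite lef_pV2 ?posrE ?ltr0n// ler_nat ltnS leq_maxl.
Qed.

Definition nullsum (c : C0 k I) : k := projT1 (cid (has_sum_exists c)).

Lemma nullsumP c : has_sum (val c) (nullsum c).
Proof. exact: projT2 (cid (has_sum_exists c)). Qed.

Lemma nullsum_linear (a : k) (c d : C0 k I) :
  nullsum (a *: c + d) = a * nullsum c + nullsum d.
Proof.
apply: has_sum_unique (nullsumP _) _.
exact: has_sumD (has_sumZ a (nullsumP c)) (nullsumP d).
Qed.

Lemma nullsum_le (c : C0 k I) C : 0 <= C -> (forall i, absv (val c i) <= C) ->
  absv (nullsum c) <= C.
Proof. by move=> C0 cC; apply: has_sum_le (nullsumP c). Qed.

Lemma nullsum1 (c : C0 k I) i : (forall j, j != i -> val c j = 0) ->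
  nullsum c = val c i.
Proof. by move=> ci; apply: has_sum_unique (nullsumP c) (has_sum1 ci). Qed.

End Summation.

(** * The pairing of null families with integral families *)

Section Pairing.
Variables (R : realType) (k : completeValFieldType R) (I : choiceType).
Implicit Types (c d : C0 k I) (a b : I -> (vint k)^o) (C : R).

Lemma C0_eqP c d : val c =1 val d -> c = d.
Proof. by move=> /funext cd; apply: val_inj. Qed.

Lemma C0_norm_le c C : 0 <= C -> (forall i, absv (val c i) <= C) -> bnorm c <= C.
Proof. exact: supnorm_le. Qed.

Lemma C0_coord_le c i : absv (val c i) <= bnorm c.
Proof. exact: supnorm_ub (C0_bounded c). Qed.

Fact unitC0_subproof (i : I) : C0_pred (fun j => (j == i)%:R : k^o).
Proof.
apply/asboolP => e e0; apply: (@sub_finite_set _ _ [set i]); last exact: finite_set1.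
by move=> j /=; have [->//|_] := eqVneq j i; rewrite absv0 leNgt e0.
Qed.

Definition unitC0 (i : I) : C0 k I := exist (@C0_pred R k I) _ (unitC0_subproof i).

Fact mulC0_subproof a c : C0_pred (fun i => val (a i) * val c i : k^o).
Proof.
apply/asboolP => e e0; apply: sub_finite_set (C0P c e0) => i /= /le_trans; apply.
by rewrite absvM ler_piMl ?absv_ge0 ?absv_vint.
Qed.

Definition mulC0 a c : C0 k I := exist (@C0_pred R k I) _ (mulC0_subproof a c).

Definition dot c a : k := nullsum (mulC0 a c).

Definition delta (i : I) : I -> (vint k)^o := fun j => (j == i)%:R.

Lemma val_delta i j : val (delta i j) = (j == i)%:R :> k.
Proof. by rewrite /delta; case: eqP. Qed.

Lemma dot_linearl a (s : k) c d : dot (s *: c + d) a = s * dot c a + dot d a.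
Proof.
rewrite -nullsum_linear; congr nullsum; apply: C0_eqP => i /=.
by rewrite mulrDr; congr (_ + _); exact: mulrCA.
Qed.

Lemma dot_linearr c : vint_linear (dot c).
Proof.
move=> s a b; rewrite -nullsum_linear; congr nullsum; apply: C0_eqP => i /=.
rewrite mulrDl; congr (_ + _); exact: esym (mulrA _ _ _).
Qed.

Lemma dot_le c a C : 0 <= C -> (forall i, absv (val c i) <= C) ->
  absv (dot c a) <= C.
Proof.
move=> C0 cC; apply: nullsum_le => // i; rewrite (le_trans _ (cC i))//=.
by rewrite absvM ler_piMl ?absv_ge0 ?absv_vint.
Qed.

Lemma dot_bounded c : bounded_map (dot c).
Proof.
by exists (bnorm c) => a; apply: dot_le (bnorm_ge0 _) _ => i; apply: C0_coord_le.
Qed.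

Lemma dot_unitC0 i a : dot (unitC0 i) a = val (a i).
Proof.
rewrite /dot (@nullsum1 _ _ _ _ i) /=; first by rewrite eqxx mulr1.
by move=> j /negbTE ->; rewrite mulr0.
Qed.

Lemma dot_delta c i : dot c (delta i) = val c i.
Proof.
rewrite /dot (@nullsum1 _ _ _ _ i) /=; first by rewrite val_delta eqxx mul1r.
by move=> j ji; rewrite val_delta (negbTE ji) mul0r.
Qed.

Definition killC0 c i : C0 k I := c - val c i *: unitC0 i.

(** Finitely many coordinates are removed one at a time, so that no finite sum
    of multiples of unit vectors has to be evaluated coordinatewise. *)
Lemma killC0s c (s : seq I) j :
  val (foldl killC0 c s) j = if j \in s then 0 else val c j.
Proof.
elim: s c => //= i s IH c; rewrite IH inE; case: ifP; rewrite ?orbT ?orbF// => _.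
have -> : val (killC0 c i) j = val c j - val c i * (j == i)%:R by [].
by have [->|_] := eqVneq j i; rewrite ?mulr1 ?mulr0 ?subrr ?subr0.
Qed.

(** Finitely supported families are dense in [C0 k I]: removing the finitely many
    coordinates of absolute value at least [e] does not change the value of [D]
    and leaves a family of norm at most [e]. *)
Lemma C0_functional_eq0 (D : C0 k I -> k) :
  (forall s c d, D (s *: c + d) = s * D c + D d) ->
  (forall c, absv (D c) <= bnorm c) -> (forall i, D (unitC0 i) = 0) ->
  forall c, D c = 0.
Proof.
move=> Dl Db D0 c; apply/eqP; rewrite -absv_eq0 eq_le absv_ge0 andbT.
apply/ler_addgt0Pr => e e0; rewrite add0r.
have Dk s d : D (foldl killC0 d s) = D d.
  elim: s d => //= i s IH d; rewrite IH /killC0 addrC -scaleNr Dl D0.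
  by rewrite mulr0 add0r.
rewrite -(Dk (fset_set [set i | e <= absv (val c i)])) (le_trans (Db _))//.
apply: C0_norm_le => [|i]; first exact: ltW.
rewrite killC0s in_fset_set; last exact: C0P.
case: ifPn => [_|]; first by rewrite absv0 ltW.
by rewrite notin_setE /= => /negP; rewrite -ltNge => /ltW.
Qed.

(** The contracting functionals on [C0 k I] are exactly the pairings with
    integral families; the family is read off at the unit vectors. *)
Lemma contr_C0E (G : contr (C0 k I) k^o) c :
  val G c = dot c (fun i => to_vint (val G (unitC0 i))).
Proof.
have G1 i : absv (val G (unitC0 i)) <= 1.
  apply: le_trans (contr_le G _) _; apply: C0_norm_le => // j /=.
  by case: eqP; rewrite ?absv1 ?absv0.
apply/eqP; rewrite -subr_eq0; apply/eqP.
pose D c := val G c - dot c (fun i => to_vint (val G (unitC0 i))).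
apply: (@C0_functional_eq0 D) => [s d d'|d|i]; rewrite /D.
- rewrite contr_linear dot_linearl mulrBr opprD addrACA; congr (_ + _).
- apply: absvB_le; first exact: contr_le.
  by apply: dot_le (bnorm_ge0 _) _ => i; apply: C0_coord_le.
- by rewrite dot_unitC0 val_to_vint ?subrr.
Qed.

End Pairing.

(** * A pseudo-Cauchy sequence without pseudo-limit *)

Section PseudoCauchy.
Variables (R : realType) (k : completeValFieldType R).

(** Reformulation of non-spherical completeness by one sequence. The balls around
    [y n] of radius [absv (y n.+1 - y n)] are nested and have no common point.
    Compared with the given balls, their radii are absolute values of elements
    of [k] and decrease strictly. Both facts matter below: the first allows
    scaling by an element of [k], the second leaves room for a norm that is only
    approximately attained. *)
Lemma exists_pseudo_cauchy : non_spherically_complete k ->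
  exists y : nat -> k,
    (forall n, absv (y n.+2 - y n.+1) < absv (y n.+1 - y n)) /\
    (forall z, ~ forall n, absv (z - y n) <= absv (y n.+1 - y n)).
Proof.
move=> [B [ballB fipB capB]].
have {}ballB n : exists cr : k * R, B n = [set x | absv (x - cr.1) <= cr.2].
  by have [c [r [_ ->]]] := ballB n; exists (c, r).
(* cr n is the centre and radius of the n-th ball. *)
have [cr BE] := choice ballB.
have close n x y : B n x -> B n y -> absv (x - y) <= (cr n).2.
  rewrite BE /= => xB yB; rewrite -(subrKA (cr n).1).
  by apply: absvD_le; rewrite // absvBC.
have meet n : exists x, forall i, (i <= n)%N -> B i x.
  have [|x xP] := fipB [fset i | i in iota 0 n.+1]%fset.
    by move=> i _; rewrite in_setT.
  exists x => i ni; apply: xP => /=.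
  have iI : i \in iota 0 n.+1 by rewrite mem_iota.
  by apply/imfsetP; exists i.
have [x xB] := choice meet.
(* If x m were within (cr n).2 of every later x n, it would lie in all balls. *)
have next m : exists n, (m < n)%N /\ (cr n).2 < absv (x n - x m).
  apply: contrapT => none.
  have : (\bigcap_n B n) (x m); last by rewrite capB.
  move=> n _; have [nm|mn] := leqP n m; first exact: xB.
  have : ~ (cr n).2 < absv (x n - x m) by move=> h; apply: none; exists n.
  move=> /negP; rewrite -leNgt absvBC => xm.
  rewrite BE /= -(subrKA (x n)); apply: absvD_le => //.
  by have := xB n n (leqnn _); rewrite BE.
have [f fP] := choice next.
(* Along s the steps are strictly larger than the radii of the balls reached,
   while each step stays within the radii of all earlier balls. *)
pose s n := iter n f 0%N.
have sS n : (s n < s n.+1)%N by have [] := fP (s n).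
have s_ge n : (n <= s n)%N by elim: n => // n IH; exact: leq_ltn_trans IH (sS n).
have far n : (cr (s n.+1)).2 < absv (x (s n.+1) - x (s n)).
  by have [] := fP (s n).
have near m n : (m <= s n)%N -> absv (x (s n.+1) - x (s n)) <= (cr m).2.
  by move=> mn; apply: close; apply: xB => //; exact: leq_trans (ltnW (sS n)).
exists (x \o s); split=> [n|z zP] /=.
  exact: le_lt_trans (near _ _ (leqnn _)) (far n).
have : (\bigcap_n B n) z; last by rewrite capB.
move=> n _; rewrite BE /= -(subrKA (x (s n))); apply: absvD_le.
  exact: le_trans (zP n) (near _ _ (s_ge n)).
by have := xB (s n) n (s_ge n); rewrite BE.
Qed.

End PseudoCauchy.

(** * Bounded functionals on integral families *)

Section BoundedFunctionals.
Variables (R : realType) (k : completeValFieldType R) (I : Type).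
Implicit Types (a b : I -> (vint k)^o).
Variable (Phi : (I -> (vint k)^o) -> k^o).
Hypotheses (Phi_linear : vint_linear Phi) (Phi_bounded : bounded_map Phi).

Lemma vint_linear0 : Phi 0 = 0.
Proof. by have := Phi_linear (-1) 0 0; rewrite scaleN1r addNr /= mulN1r addNr. Qed.

Lemma vint_linearZ (c : vint k) a : Phi (c *: a) = val c * Phi a.
Proof. by have := Phi_linear c a 0; rewrite vint_linear0 !addr0. Qed.

Lemma vint_linearD a b : Phi (a + b) = Phi a + Phi b.
Proof. by have := Phi_linear 1 a b; rewrite scale1r mul1r. Qed.

Lemma vint_linearB a b : Phi (a - b) = Phi a - Phi b.
Proof.
by have := Phi_linear (-1) b a; rewrite scaleN1r /= mulN1r addrC => ->; rewrite addrC.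
Qed.

(** The bound scales with the argument although [w] need not be integral: for
    [w] outside the unit ball the estimate is trivial, for [w] inside it one can
    divide the argument by [w]. *)
Lemma bounded_scale (w : k) a : (forall i, absv (val (a i)) <= absv w) ->
  absv (Phi a) <= absv w * supnorm Phi.
Proof.
move=> aw; have [w1|w1] := leP (absv w) 1; last first.
  rewrite (le_trans (supnorm_ub a Phi_bounded))// ler_peMl ?(ltW w1)//.
  exact: supnorm_ge0 Phi_bounded.
have [w0|w0] := eqVneq w 0.
  have -> : a = 0.
    apply/funext => i; apply: val_inj; apply/eqP; rewrite -absv_eq0 eq_le absv_ge0.
    by rewrite (le_trans (aw i))// w0 absv0.
  by rewrite vint_linear0 absv0 w0 absv0 mul0r.
have w_gt0 : 0 < absv w by rewrite absv_gt0.
have -> : a = to_vint w *: ((fun i => to_vint (val (a i) / w)) : I -> (vint k)^o).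
  apply/funext => i; apply: val_inj => /=.
  rewrite !val_to_vint//; first by rewrite mulrC divfK.
  by rewrite absvM absvV ler_pdivrMr// mul1r; exact: aw.
rewrite vint_linearZ val_to_vint// absvM ler_wpM2l ?absv_ge0//.
exact: supnorm_ub Phi_bounded.
Qed.

(** The supremum norm need not be attained, but any fraction [c < 1] of it is. The
    constant [c] may be negative, hence the maximum with 0 in the proof. *)
Lemma near_norming (c : R) : c < 1 -> supnorm Phi != 0 ->
  exists a, Phi a != 0 /\ supnorm Phi * c <= absv (Phi a).
Proof.
move=> c1 S0; have S_gt0 : 0 < supnorm Phi by rewrite lt_def S0 (supnorm_ge0 Phi_bounded).
pose d := Num.max c 0.
have d1 : d < 1 by rewrite gt_max c1 ltr01.
apply: contrapT => none.
have : supnorm Phi <= supnorm Phi * d.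
  apply: supnorm_le => [|a].
    by rewrite mulr_ge0 ?(supnorm_ge0 Phi_bounded)// le_max lexx orbT.
  have [->|Pa] := eqVneq (Phi a) 0.
    by rewrite absv0 mulr_ge0 ?(supnorm_ge0 Phi_bounded)// le_max lexx orbT.
  rewrite leNgt; apply/negP => da; apply: none; exists a; split=> //.
  by apply: le_trans (ltW da); rewrite ler_pM2l// le_max lexx.
by rewrite leNgt gtr_pMr// d1.
Qed.

End BoundedFunctionals.

(** * Functionals on integral sequences *)

Section SequenceFunctionals.
Variables (R : realType) (k : completeValFieldType R).
Hypothesis k_non_spherical : non_spherically_complete k.
Implicit Types (x : nat -> (vint k)^o).

Section Vanishing.
Variable g : (nat -> (vint k)^o) -> k^o.
Hypotheses (g_linear : vint_linear g) (g_bounded : bounded_map g).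
Hypothesis g_delta : forall n, g (delta k n) = 0.

Lemma kills_finitely_supported N x : (forall m, (N <= m)%N -> x m = 0) -> g x = 0.
Proof.
elim: N x => [|N IH] x x0.
  by rewrite (_ : x = 0) ?(vint_linear0 g_linear)//; apply/funext => m; exact: x0.
have -> : g x = g (x - x N *: delta k N).
  by rewrite (vint_linearB g_linear) (vint_linearZ g_linear) g_delta mulr0 subr0.
apply: IH => m; rewrite leq_eqVlt => /predU1P[<-|Nm].
  by rewrite !fctE /delta eqxx [_ *: _]mulr1 subrr.
by rewrite !fctE /delta gtn_eqF// [_ *: _]mulr0 subr0; exact: x0.
Qed.

(** Suppose [g] is not 0, of norm [S]. Take a pseudo-Cauchy sequence [y] without
    pseudo-limit, with steps [d n = y n.+1 - y n], and lift a multiple [t * d n.+1]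
    of each step to an integral sequence [z n] with [g (z n) = t * d n.+1]. The
    sequences [z n] are summed in the quotient by finitely supported sequences,
    which [g] does not see: the [m]-th coordinate of [b] is the finite sum of the
    [m]-th coordinates of [z 0, ..., z m.-1], so from the coordinate [N] on
    the difference of [b] and the sum of [z 0, ..., z N.-1] obeys the bound by
    [t * w N] that holds for [z N].
    Therefore [g b / t + y 1] is a pseudo-limit of [y], a contradiction.

    In other words, bounded sequences modulo finitely supported ones are
    spherically complete over any complete [k], and a nonzero bounded functional
    would make [k] spherically complete too. *)
Lemma functional_seq_eq0 x : g x = 0.
Proof.
apply/eqP; apply: contrapT => /negP gx.
have S0 : supnorm g != 0.
  by rewrite supnorm_eq0//; apply: contraNneq gx => ->.
have S_gt0 : 0 < supnorm g by rewrite lt_def S0 (supnorm_ge0 g_bounded).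
have [y [d_lt no_limit]] := exists_pseudo_cauchy k_non_spherical.
pose d n := y n.+1 - y n.
have d_gt0 n : 0 < absv (d n) by apply: le_lt_trans (d_lt n); exact: absv_ge0.
(* The ratio of consecutive steps is the loss that the norm estimate can
   afford: it turns a bound by d n.+1 into one by d n. *)
have norming n : exists a, g a != 0 /\
    supnorm g * (absv (d n.+1) / absv (d n)) <= absv (g a).
  by apply: near_norming => //; rewrite ltr_pdivrMr// mul1r; exact: d_lt.
have [a aP] := choice norming.
pose w n := d n.+1 / g (a n).
have ga_gt0 n : 0 < absv (g (a n)) by rewrite absv_gt0; have [] := aP n.
have w_le n : absv (w n) * supnorm g <= absv (d n).
  have [_ h] := aP n; rewrite absvM absvV mulrAC ler_pdivrMr// mulrC.
  by move: h; rewrite mulrA ler_pdivrMr// [_ * absv (d n)]mulrC.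
have w_dec n : absv (w n.+1) <= absv (w n).
  rewrite -(ler_pM2r S_gt0) (le_trans (w_le _))// absvM absvV.
  by rewrite mulrAC ler_pdivlMr// ler_wpM2l ?absv_ge0// (supnorm_ub _ g_bounded).
have w_le_w m n : (m <= n)%N -> absv (w n) <= absv (w m).
  move=> /subnK <-; elim: (n - m)%N => // j IH.
  by rewrite addSn (le_trans (w_dec _)).
have w0 n : w n != 0.
  by rewrite -absv_gt0 absvM absvV mulr_gt0 ?invr_gt0.
(* All w n have to become integral, and w 0 is the largest of them. *)
pose t := (w 0%N)^-1.
have t0 : t != 0 by rewrite invr_eq0.
have tw n : absv (t * w n) <= 1.
  by rewrite absvM absvV ler_pdivrMl ?absv_gt0// mulr1 w_le_w.
pose z n : nat -> (vint k)^o := to_vint (t * w n) *: a n.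
have gz n : g (z n) = t * d n.+1.
  by rewrite (vint_linearZ g_linear) val_to_vint// -mulrA divfK//; have [] := aP n.
pose P N : nat -> (vint k)^o := fun m => \sum_(0 <= n < N) z n m.
have gP N : g (P N) = t * (y N.+1 - y 1%N).
  elim: N => [|N IH].
    rewrite subrr mulr0 (_ : P 0%N = 0) ?(vint_linear0 g_linear)//.
    by apply/funext => m; rewrite /P big_nil.
  rewrite (_ : P N.+1 = P N + z N).
    by rewrite (vint_linearD g_linear) IH gz -mulrDr /d; congr (_ * _); ring.
  by apply/funext => m; rewrite /P big_nat_recr.
pose b : nat -> (vint k)^o := fun m => P m m.
have approx N : absv (g b - g (P N)) <= absv t * absv (d N).
  pose h : nat -> (vint k)^o := fun m => if (N <= m)%N then b m - P N m else 0.
  have -> : g b - g (P N) = g h.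
    rewrite -(vint_linearB g_linear); apply/eqP; rewrite -subr_eq0.
    rewrite -(vint_linearB g_linear); apply/eqP.
    apply: (@kills_finitely_supported N) => m Nm.
    by rewrite !fctE /h Nm subrr.
  apply: le_trans (_ : absv (t * w N) * supnorm g <= _); last first.
    by rewrite absvM -mulrA ler_wpM2l ?absv_ge0.
  apply: bounded_scale => // m; rewrite /h; case: ifP => Nm; last first.
    by rewrite absv0 absv_ge0.
  rewrite /b /P (@big_cat_nat _ _ _ N 0 m)//= addrAC subrr add0r.
  apply: absv_vint_sum_le; first exact: absv_ge0.
  move=> n; rewrite mem_index_iota => /andP[Nn _] _.
  rewrite /z /= val_to_vint// absvM (@le_trans _ _ (absv (t * w n)))//.
    by rewrite ler_piMr ?absv_ge0 ?absv_vint.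
  by rewrite !(absvM t) ler_wpM2l ?absv_ge0// w_le_w.
apply: (no_limit (g b / t + y 1%N)) => n.
have -> : g b / t + y 1%N - y n = (g b - g (P n)) / t + d n.
  by rewrite gP /d; field.
apply: absvD_le => //; rewrite absvM absvV ler_pdivrMr ?absv_gt0// mulrC.
exact: approx.
Qed.

End Vanishing.

End SequenceFunctionals.

(** * Functionals along disjoint families *)

Lemma infinite_injection (T : Type) (A : set T) : infinite_set A ->
  exists f : nat -> T, injective f /\ forall n, A (f n).
Proof.
move=> /infiniteP/card_leP[f].
exists (fun n => set_val (f (SigSub (mem_set (I : [set: nat] n))))).
split=> [m n /val_inj/(inj (f := f))|n]; last exact: set_valP.
by rewrite !inE => /(_ Logic.I Logic.I)[].
Qed.

Section Labels.
Variable I : Type.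

(** A labelling encodes a sequence of disjoint sets, the set of index [n] being
    made of the points labelled [Some n]. Taking the first index makes an
    arbitrary sequence of sets disjoint without changing its union. *)
Definition first_index (P : nat -> set I) (i : I) : option nat :=
  match pselect (exists n, `[< P n i >]) with
  | left h => Some (ex_minn h)
  | right _ => None
  end.

Lemma first_indexP (P : nat -> set I) i n :
  first_index P i = Some n <-> P n i /\ forall m, (m < n)%N -> ~ P m i.
Proof.
rewrite /first_index; case: pselect => [h|h]; last first.
  by split=> // -[Pn _]; case: h; exists n; apply/asboolP.
case: ex_minnP => j /asboolP Pj jmin; split=> [[<-]|[Pn nmin]].
  by split=> // m mj /asboolP/jmin; rewrite leqNgt mj.
congr Some; apply/eqP; rewrite eqn_leq; apply/andP; split.
  exact/jmin/asboolP.
by rewrite leqNgt; apply/negP => /nmin; apply.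
Qed.

End Labels.

Section FunctionalCalculus.
Variables (R : realType) (k : completeValFieldType R).

Section Precomposition.
Variables (I J : Type) (Phi : (I -> (vint k)^o) -> k^o).
Variable T : (J -> (vint k)^o) -> (I -> (vint k)^o).

Lemma vint_linear_precomp : linear T -> vint_linear Phi ->
  vint_linear (fun x => Phi (T x)).
Proof. by move=> Tl Pl c x y; rewrite Tl Pl. Qed.

Lemma bounded_map_precomp : bounded_map Phi -> bounded_map (fun x => Phi (T x)).
Proof. by move=> [C PC]; exists C => x; exact: PC. Qed.

End Precomposition.

Section Difference.
Variables (I : Type) (Phi Psi : (I -> (vint k)^o) -> k^o).

Lemma vint_linear_sub : vint_linear Phi -> vint_linear Psi ->
  vint_linear (fun x => Phi x - Psi x).
Proof. by move=> Pl Ql c x y; rewrite Pl Ql mulrBr opprD addrACA. Qed.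

Lemma bounded_map_sub : bounded_map Phi -> bounded_map Psi ->
  bounded_map (fun x => Phi x - Psi x).
Proof.
move=> [C PC] [D QD]; exists (Num.max C D) => x.
by apply: absvB_le; rewrite le_max ?PC ?QD ?orbT.
Qed.

End Difference.

(** The sum of the families [x n * a] restricted to the points labelled [n].
    Precomposing a functional with [spread a p] turns questions on a disjoint
    family of sets into questions on integral sequences. *)
Definition spread (I : Type) (a : I -> (vint k)^o) (p : I -> option nat)
    (x : nat -> (vint k)^o) : I -> (vint k)^o :=
  fun i => a i * oapp x 0 (p i).

Lemma spread_linear (I : Type) (a : I -> (vint k)^o) p : linear (spread a p).
Proof.
move=> c x y; apply/funext => i; rewrite /spread !fctE.
case: (p i) => [n|] /=; last by rewrite !mulr0 scaler0 addr0.
by rewrite mulrDr scalerAr.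
Qed.

Lemma spread_delta (I : Type) (a : I -> (vint k)^o) p n :
  spread a p (delta k n) = fun i => if p i == Some n then a i else 0.
Proof.
apply/funext => i; rewrite /spread /delta; case: (p i) => [m|] /=; last by rewrite mulr0.
by rewrite (inj_eq Some_inj); case: eqP; rewrite ?mulr1 ?mulr0.
Qed.

End FunctionalCalculus.

Section NullCoefficients.
Variables (R : realType) (k : completeValFieldType R).
Hypothesis k_nontrivial : nontrivially_valued k.
Hypothesis k_non_spherical : non_spherically_complete k.

(** Powers of a scalar of absolute value less than 1 tend to 0, by the Bernoulli
    inequality for the inverse of this absolute value. *)
Lemma exists_small_scalar (e : R) : 0 < e ->
  exists t : k, t != 0 /\ absv t <= e.
Proof.
move=> e0; have [c [c0 c1]] : exists c : k, c != 0 /\ absv c < 1.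
  have [c [c0 /eqP]] := k_nontrivial; rewrite neq_lt => /orP[c1|c1].
    by exists c.
  by exists c^-1; rewrite invr_eq0 absvV invf_lt1 ?absv_gt0.
have ac : 0 < absv c by rewrite absv_gt0.
pose q := (absv c)^-1 - 1.
have q0 : 0 < q by rewrite subr_gt0 invf_gt1.
have bern n : n%:R * q <= (1 + q) ^+ n.
  suff h : 1 + n%:R * q <= (1 + q) ^+ n by apply: le_trans h; rewrite lerDr.
  elim: n => [|n IH]; first by rewrite mul0r addr0.
  have nq : 0 <= n%:R * q by rewrite mulr_ge0// ltW.
  rewrite exprS (@le_trans _ _ ((1 + q) * (1 + n%:R * q)))//; last first.
    by rewrite ler_pM2l// addr_gt0.
  have : 0 <= q * (n%:R * q) by rewrite mulr_ge0// ltW.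
  by rewrite -natr1; lra.
have [n nP] := exists_small (mulr_gt0 e0 q0).
exists (c ^+ n.+1); split; first by rewrite expf_neq0.
have -> : absv (c ^+ n.+1) = absv c ^+ n.+1.
  by elim: (n.+1) => [|m IH]; rewrite ?expr0 ?absv1// !exprS absvM IH.
have cq : absv c = (1 + q)^-1 by rewrite /q addrC subrK invrK.
have q1 : 0 < 1 + q by rewrite addr_gt0.
rewrite cq exprVn invf_ple ?posrE ?exprn_gt0// (le_trans _ (bern n.+1))//.
move: nP; rewrite invf_ple ?posrE ?ltr0n ?mulr_gt0// invfM => nP.
by rewrite -ler_pdivrMr.
Qed.

(** A shift argument. Rescale so that [g] takes the same value [t] at all
    [delta n]. Then [g] and its composite with the shift agree on every
    [delta n], hence everywhere; evaluated at the constant sequence [1] this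
    says that [g] vanishes at [1 - shift 1 = delta 0]. *)
Lemma deltas_not_bounded_below (g : (nat -> (vint k)^o) -> k^o) (e : R) :
  vint_linear g -> bounded_map g -> 0 < e -> ~ (forall n, e <= absv (g (delta k n))).
Proof.
move=> gl gb e0 ge.
have [t [t0 te]] := exists_small_scalar e0.
pose s : nat -> (vint k)^o := fun n => to_vint (t / g (delta k n)).
have gd n : 0 < absv (g (delta k n)) by exact: lt_le_trans e0 (ge n).
pose g' := fun x => g (spread s Some x).
have g'l : vint_linear g' by apply: vint_linear_precomp gl; exact: spread_linear.
have g'b : bounded_map g' by exact: bounded_map_precomp gb.
have g'd n : g' (delta k n) = t.
  rewrite /g' spread_delta.
  rewrite (_ : (fun i => _) = (s n : vint k) *: delta k n); last first.
    apply/funext => i; rewrite !fctE /delta (inj_eq Some_inj).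
    by have [->|_] := eqVneq i n; [rewrite [RHS]mulr1|rewrite [RHS]mulr0].
  rewrite (vint_linearZ gl) val_to_vint ?divfK// -?absv_gt0//.
  by rewrite absvM absvV ler_pdivrMr// mul1r (le_trans te).
pose p n := if n is m.+1 then Some m else None.
have sh n : spread (fun=> 1) p (delta k n) = delta k n.+1.
  rewrite spread_delta; apply/funext => -[|i] //.
  by rewrite /delta /= (inj_eq Some_inj) eqSS; case: eqP.
have shift x : g' x = g' (spread (fun=> 1) p x).
  apply/eqP; rewrite -subr_eq0; apply/eqP.
  pose g'' := fun x => g' x - g' (spread (fun=> 1) p x).
  apply: (@functional_seq_eq0 _ _ k_non_spherical g'') => [||n].
  - apply: vint_linear_sub => //.
    by apply: vint_linear_precomp g'l; exact: spread_linear.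
  - by apply: bounded_map_sub => //; exact: bounded_map_precomp g'b.
  - by rewrite /g'' sh !g'd subrr.
move: t0; rewrite -(g'd 0%N) (_ : delta k 0%N = 1 - spread (fun=> 1) p 1).
  by rewrite (vint_linearB g'l) -shift subrr eqxx.
by apply/funext => -[|i]; rewrite !fctE /delta /spread /= ?mulr0 ?subr0 ?mulr1 ?subrr.
Qed.

Section Coefficients.
Variables (I : choiceType) (Phi : (I -> (vint k)^o) -> k^o).
Hypotheses (Phi_linear : vint_linear Phi) (Phi_bounded : bounded_map Phi).

(** Were infinitely many coefficients at least [e] in absolute value, a sequence
    of distinct indices would give a functional on integral sequences excluded by
    the shift argument. *)
Lemma delta_null : C0_pred (fun i => Phi (delta k i)).
Proof.
apply/asboolP => e e0; apply: contrapT => /infinite_injection[f [f_inj fe]].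
pose p := first_index (fun n => [set f n]).
have pE i n : (p i == Some n) = (i == f n).
  apply/eqP/eqP => [/first_indexP[]//|->]; apply/first_indexP; split=> // m mn.
  by move=> /= /f_inj nm; rewrite nm ltnn in mn.
pose g := fun x => Phi (spread (fun=> 1) p x).
apply: (@deltas_not_bounded_below g _ _ _ e0) => [||n].
- by apply: vint_linear_precomp Phi_linear; exact: spread_linear.
- exact: bounded_map_precomp Phi_bounded.
- rewrite /g spread_delta (_ : (fun i => _) = delta k (f n)); first exact: fe.
  by apply/funext => i; rewrite /delta pE; case: eqP.
Qed.

Definition coefC0 : C0 k I := exist (@C0_pred R k I) _ delta_null.

Lemma coefC0_rest_delta i : Phi (delta k i) - dot coefC0 (delta k i) = 0.
Proof. by rewrite dot_delta subrr. Qed.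

Lemma coefC0_rest_linear : vint_linear (fun a => Phi a - dot coefC0 a).
Proof. exact: vint_linear_sub Phi_linear (dot_linearr _). Qed.

Lemma coefC0_rest_bounded : bounded_map (fun a => Phi a - dot coefC0 a).
Proof. exact: bounded_map_sub Phi_bounded (dot_bounded _). Qed.

End Coefficients.

(** The functional is the pairing with its null sequence of coefficients, since
    the difference vanishes on all [delta k n]. *)
Lemma sequence_functional_le (g : (nat -> (vint k)^o) -> k^o) (C : R) x :
  vint_linear g -> bounded_map g -> (forall n, absv (g (delta k n)) <= C) ->
  absv (g x) <= C.
Proof.
move=> gl gb gC.
have := @functional_seq_eq0 _ _ k_non_spherical _ (coefC0_rest_linear gl gb)
  (coefC0_rest_bounded gl gb) (coefC0_rest_delta gl gb) x.
move=> /eqP; rewrite subr_eq0 => /eqP ->.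
by apply: dot_le => //; exact: le_trans (absv_ge0 _) (gC 0%N).
Qed.

End NullCoefficients.

(** * Functionals and measurable cardinals *)

Section Measurability.
Variables (R : realType) (k : completeValFieldType R).
Hypothesis k_nontrivial : nontrivially_valued k.
Hypothesis k_non_spherical : non_spherically_complete k.
Variables (I : choiceType) (Phi : (I -> (vint k)^o) -> k^o).
Hypotheses (Phi_linear : vint_linear Phi) (Phi_bounded : bounded_map Phi).
Hypothesis Phi_delta : forall i, Phi (delta k i) = 0.

(** [B |-> Phi (restrict_to B)] is a finitely additive measure with values in [k]
    that vanishes on points. It is even countably additive, by the result on
    sequences, and its values tend to 0 along disjoint sets. *)
Section Ideal.
Variables (a : I -> (vint k)^o) (e : R).
Hypotheses (e_gt0 : 0 < e) (Phi_a : e < absv (Phi a)).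

Definition restrict_to (B : set I) : I -> (vint k)^o :=
  fun i => if `[< B i >] then a i else 0.

(** All subsets are tested because the measure is not monotone. The inequality is
    large so that it survives countable sums. *)
Definition negligible (A : set I) : Prop :=
  forall B, B `<=` A -> absv (Phi (restrict_to B)) <= e.

Lemma negligible_sub A B : A `<=` B -> negligible B -> negligible A.
Proof. by move=> AB nB C CA; apply: nB; exact: subset_trans CA AB. Qed.

Lemma not_negligibleT : ~ negligible [set: I].
Proof.
move=> /(_ setT (fun _ => id)); rewrite leNgt (_ : restrict_to _ = a) ?Phi_a//.
by apply/funext => i; rewrite /restrict_to asboolT.
Qed.

(** A subset of the union is cut into countably many disjoint negligible pieces.
    Its measure is the value at the constant sequence 1 of a functional whose
    coefficients are the measures of the pieces. *)
Lemma negligible_bigcup (A : nat -> set I) :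
  (forall n, negligible (A n)) -> negligible (\bigcup_n A n).
Proof.
move=> nA B BA; pose p := first_index A.
pose g := fun x => Phi (spread (restrict_to B) p x).
have -> : restrict_to B = spread (restrict_to B) p 1.
  apply/funext => i; rewrite /spread.
  case pi : (p i) => [n|] /=; first by rewrite mulr1.
  rewrite mulr0 /restrict_to; case: asboolP => // /BA[n _ An].
  suff [m pm] : exists m, p i = Some m by rewrite pm in pi.
  have h : exists n, `[< A n i >] by exists n; apply/asboolP.
  exists (ex_minn h); apply/first_indexP; case: ex_minnP => m /asboolP Am mmin.
  by split=> // j jm /asboolP/mmin; rewrite leqNgt jm.
apply: (sequence_functional_le k_nontrivial k_non_spherical (g := g)) => [||n].
- by apply: vint_linear_precomp Phi_linear; exact: spread_linear.
- exact: bounded_map_precomp Phi_bounded.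
- rewrite /g spread_delta.
  rewrite (_ : (fun i => _) = restrict_to (B `&` [set i | p i = Some n])).
    by apply: (nA n) => i [_ /first_indexP[]].
  apply/funext => i; rewrite /restrict_to asbool_and.
  case: eqP => /= pin; case: asboolP => Bi; rewrite ?andbF//=; last by rewrite asboolF.
  by rewrite asboolT.
Qed.

Lemma negligibleU A B : negligible A -> negligible B -> negligible (A `|` B).
Proof.
move=> nA nB; pose C n := if n is 0%N then A else B.
apply: (@negligible_sub _ (\bigcup_n C n)); last by apply: negligible_bigcup => -[].
by move=> i [Ai|Bi]; [exists 0%N|exists 1%N].
Qed.

Lemma negligible_subsingleton (A : set I) :
  (forall i j, A i -> A j -> i = j) -> negligible A.
Proof.
move=> A1 B BA; have [[i Bi]|B0] := pselect (exists i, B i).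
  rewrite (_ : restrict_to B = (a i : vint k) *: delta k i).
    by rewrite (vint_linearZ Phi_linear) Phi_delta mulr0 absv0 ltW.
  apply/funext => j; rewrite /restrict_to !fctE /delta; case: asboolP => Bj.
    by rewrite (A1 _ _ (BA _ Bj) (BA _ Bi)) eqxx [RHS]mulr1.
  by rewrite (_ : j == i = false) ?[RHS]mulr0//; apply/eqP => ji; rewrite ji in Bj.
rewrite (_ : restrict_to B = 0); first by rewrite (vint_linear0 Phi_linear) absv0 ltW.
by apply/funext => j; rewrite /restrict_to asboolF// => Bj; apply: B0; exists j.
Qed.

(** The differences [A n `\` A n.+1] are disjoint and contain sets of measure
    larger than [e], whereas the measure tends to 0 along disjoint sets. *)
Lemma no_infinite_splitting (A : nat -> set I) :
  (forall n, A n.+1 `<=` A n) -> ~ (forall n, ~ negligible (A n `\` A n.+1)).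
Proof.
move=> Adec nA.
have Amono m n : (m <= n)%N -> A n `<=` A m.
  move=> /subnK <-; elim: (n - m)%N => // j IH.
  by rewrite addSn; exact: subset_trans (Adec _) IH.
have /choice[B BP] n : exists B, B `<=` A n `\` A n.+1 /\ e < absv (Phi (restrict_to B)).
  apply: contrapT => none; apply: (nA n) => B BA; rewrite leNgt; apply/negP => eB.
  by apply: none; exists B.
pose p := first_index B.
have pE i n : p i = Some n <-> B n i.
  split=> [/first_indexP[]//|Bi]; apply/first_indexP; split=> // m mn Bm.
  have [/(_ _ Bm)[_ nAm] _] := BP m; have [/(_ _ Bi)[An _] _] := BP n.
  exact/nAm/(Amono _ _ mn).
apply: (@deltas_not_bounded_below _ _ k_nontrivial k_non_spherical
  (fun x => Phi (spread a p x)) e) => // [||n].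
- by apply: vint_linear_precomp Phi_linear; exact: spread_linear.
- exact: bounded_map_precomp Phi_bounded.
- rewrite spread_delta (_ : (fun i => _) = restrict_to (B n)).
    by have [_ /ltW] := BP n.
  apply/funext => i; rewrite /restrict_to; case: asboolP => Bi.
    by rewrite (proj2 (pE i n) Bi) eqxx.
  by case: eqP => // /pE.
Qed.

(** Otherwise every set outside the ideal splits into two such sets, and iterating
    the splitting contradicts the previous lemma. *)
Lemma exists_atom : exists A, ~ negligible A /\
  forall B, B `<=` A -> negligible B \/ negligible (A `\` B).
Proof.
apply: contrapT => none.
have /choice[f fP] A : exists B, ~ negligible A ->
    [/\ B `<=` A, ~ negligible B & ~ negligible (A `\` B)].
  have [nA|/contrapT nA] := pselect (~ negligible A); last by exists set0.
  apply: contrapT => noB; apply: none; exists A; split=> // B BA.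
  apply: contrapT => /not_orP[nB nAB]; apply: noB.
  by exists B => _; split.
pose A n := iter n f [set: I].
have nA n : ~ negligible (A n).
  elim: n => [|n IH]; first exact: not_negligibleT.
  by have [] := fP _ IH.
apply: (@no_infinite_splitting A) => n; by have [] := fP _ (nA n).
Qed.

(** The sets that contain an atom up to a negligible set form a countably complete
    ultrafilter. It contains no singleton, points being negligible, and for the
    same reason [I] is uncountable. *)
Lemma measurable_card_of_functional : measurable_card I.
Proof.
split.
  move=> /countable_injP[f f_inj]; apply: not_negligibleT.
  apply: (@negligible_sub _ (\bigcup_n [set i | f i = n])).
    by move=> i _; exists (f i).
  apply: negligible_bigcup => n; apply: negligible_subsingleton => i j /= <- /esym.
  by apply: f_inj; rewrite in_setT.
have [A [nA atomA]] := exists_atom.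
exists [set B | negligible (A `\` B)]; split.
- have F : ProperFilter [set B | negligible (A `\` B)].
    split; first by rewrite /= setD0.
    split=> /= [|B C nB nC|B C BC].
    + by rewrite /= setDT; apply: negligible_subsingleton.
    + by rewrite /= setDIr; exact: negligibleU.
    + by apply: negligible_sub; exact: setDS.
  split=> // G GF UG; apply/seteqP; split=> // B GB /=.
  have [nAB|] := atomA (A `&` B) (@subIsetl _ A B); last by rewrite setDIr setDv set0U.
  have /UG : [set B | negligible (A `\` B)] (~` B) by rewrite /= setDE setCK.
  move=> /(filterI GB); rewrite setICr => /filter_not_empty; by [].
- move=> i Ui; apply: nA.
  have : [set B | negligible (A `\` B)] [set i] by rewrite Ui; exact/principal_filterP.
  move=> /= nAi; apply: (@negligible_sub _ ((A `\` [set i]) `|` [set i])).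
    by move=> j Aj; have [->|ji] := pselect (j = i); [right|left].
  by apply: negligibleU => //; apply: negligible_subsingleton => x y /= -> ->.
- move=> B nB /=; rewrite (_ : A `\` _ = \bigcup_n (A `\` B n)).
    exact: negligible_bigcup.
  by rewrite setDE setC_bigcap setI_bigcupr.
Qed.

End Ideal.

Lemma functional_eq0 : ~ measurable_card I -> forall a, Phi a = 0.
Proof.
move=> nI a; apply: contrapT => /eqP Pa; apply: nI.
have Pa0 : 0 < absv (Phi a) by rewrite absv_gt0.
apply: (@measurable_card_of_functional a (absv (Phi a) / 2)).
  by rewrite divr_gt0.
by rewrite ltr_pdivrMr// ltr_pMr// ltr1n.
Qed.

End Measurability.

Section Representation.
Variables (R : realType) (k : completeValFieldType R).
Hypothesis k_nontrivial : nontrivially_valued k.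
Hypothesis k_non_spherical : non_spherically_complete k.

(** Subtracting the pairing with the coefficients leaves a functional that kills
    every [delta k i], hence vanishes when [I] is not measurable. *)
Lemma functionalE (I : choiceType) (Phi : (I -> (vint k)^o) -> k^o) :
  ~ measurable_card I -> vint_linear Phi -> bounded_map Phi ->
  exists c : C0 k I, forall a, Phi a = dot c a.
Proof.
move=> nI Pl Pb; exists (coefC0 k_nontrivial k_non_spherical Pl Pb) => a.
apply/eqP; rewrite -subr_eq0; apply/eqP.
exact: (functional_eq0 k_nontrivial k_non_spherical (coefC0_rest_linear _ _ Pl Pb)
  (coefC0_rest_bounded _ _ Pl Pb) (coefC0_rest_delta _ _ Pl Pb) nI).
Qed.

End Representation.

(** * Criteria for isomorphism *)

Section Inverses.
Variables (R : realType) (k : completeValFieldType R).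

Lemma linear_inverse (A : pzRingType) (M N : lmodType A) (f : M -> N) :
  linear f -> injective f -> (forall y, exists x, f x = y) ->
  exists g : N -> M, [/\ linear g, cancel f g & cancel g f].
Proof.
move=> fl fi /choice[g gK]; have fK : cancel f g by move=> x; apply: fi; rewrite gK.
exists g; split=> // a x y; apply: fi.
by rewrite fl !gK.
Qed.

Lemma isometry_inverse (V W : banachType k) (f : V -> W) :
  linear f -> (forall v, bnorm (f v) = bnorm v) -> (forall w, exists v, f v = w) ->
  exists g : W -> V,
    [/\ linear g, forall w, bnorm (g w) = bnorm w, cancel f g & cancel g f].
Proof.
move=> fl fn fs.
have f_inj : injective f.
  move=> v w fvw; apply/eqP; rewrite -subr_eq0 -bnorm_eq0 -fn.
  by rewrite addrC -scaleN1r fl fvw scaleN1r addNr bnorm_eq0.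
have [g [gl fK gK]] := linear_inverse fl f_inj fs.
by exists g; split=> // w; rewrite -fn gK.
Qed.

Lemma isometry_isomorphism (V W : banachType k) (f : contr V W) :
  (forall v, bnorm (val f v) = bnorm v) -> (forall w, exists v, val f v = w) ->
  isomorphism (C := banCat k) f.
Proof.
move=> fn fs; have [g [gl gn fK gK]] := isometry_inverse (contr_linear f) fn fs.
have gc w : bnorm (g w) <= bnorm w by rewrite gn.
by exists (contrS gl gc); split; apply: contr_eqP => x /=; rewrite ?fK ?gK.
Qed.

Lemma bijective_isomorphism (A : comNzRingType) (M N : lmodType A) (f : mhom M N) :
  injective (val f) -> (forall y, exists x, val f x = y) ->
  isomorphism (C := modCat A) f.
Proof.
move=> fi fs; have [g [gl fK gK]] := linear_inverse (mhomP f) fi fs.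
by exists (mhomS gl); split; apply: mhom_eqP => x /=; rewrite ?fK ?gK.
Qed.

End Inverses.

(** * Evaluation maps into the double duals *)

Section Evaluation.
Variables (R : realType) (k : completeValFieldType R).

Section EvalBanach.
Variable V : banachType k.

Fact evalB_linear_subproof (v : V) : vint_linear (fun g : dualB V => val g v).
Proof. by []. Qed.

Fact evalB_bounded_subproof (v : V) : bounded_map (fun g : dualB V => val g v).
Proof. by exists (bnorm v) => g; exact: contr_le. Qed.

Definition evalB_fun (v : V) : dualM (dualB V) :=
  dualMS (evalB_linear_subproof v) (evalB_bounded_subproof v).

Fact evalB_linear : linear evalB_fun.
Proof. by move=> a v w; apply: dualM_eqP => g /=; exact: (contr_linear g). Qed.

Fact evalB_le v : bnorm (evalB_fun v) <= bnorm v.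
Proof. by apply: supnorm_le (bnorm_ge0 _) _ => g; exact: contr_le. Qed.

Definition evalB : contr V (dualM (dualB V)) := contrS evalB_linear evalB_le.

End EvalBanach.

Section EvalModule.
Variable M : lmodType (vint k).

Fact evalM_linear_subproof (m : M) : linear (fun F : dualM M => val F m : k^o).
Proof. by []. Qed.

Fact evalM_le_subproof (m : M) (F : dualM M) : bnorm (val F m : k^o) <= bnorm F.
Proof. exact: supnorm_ub (dualM_bounded F). Qed.

Definition evalM_fun (m : M) : dualB (dualM M : banachType k) :=
  contrS (@evalM_linear_subproof m) (@evalM_le_subproof m).

Fact evalM_linear : linear evalM_fun.
Proof. by move=> a m n; apply: contr_eqP => F /=; exact: (dualM_linear F). Qed.

Definition evalM : mhom M (dualB (dualM M : banachType k)) := mhomS evalM_linear.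

End EvalModule.

End Evaluation.

(** * Duals of free Banach spaces and of cofree modules *)

Section FreeBanach.
Variables (R : realType) (k : completeValFieldType R).
Variables (I : choiceType) (V : banachType k) (phi : V -> C0 k I).
Hypotheses (phi_linear : linear phi) (phi_norm : forall v, bnorm (phi v) = bnorm v).

Fact functional_of_linear (b : I -> (vint k)^o) :
  linear (fun v => dot (phi v) b : k^o).
Proof. by move=> a v w; rewrite phi_linear dot_linearl. Qed.

Fact functional_of_le (b : I -> (vint k)^o) v :
  bnorm (dot (phi v) b : k^o) <= bnorm v.
Proof.
by rewrite -phi_norm; apply: dot_le (bnorm_ge0 _) _ => i; exact: C0_coord_le.
Qed.

Definition functional_of b : dualB V :=
  contrS (@functional_of_linear b) (@functional_of_le b).

Lemma functional_of_is_linear : linear functional_of.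
Proof. by move=> c a b; apply: contr_eqP => v /=; exact: dot_linearr. Qed.

Variable psi : C0 k I -> V.
Hypotheses (phiK : cancel phi psi) (psiK : cancel psi phi).

Lemma functional_of_inj : injective functional_of.
Proof.
move=> a b ab; apply/funext => i; apply: val_inj.
by rewrite -!dot_unitC0 -(psiK (unitC0 k i)); exact: (congr1 (fun g => val g _) ab).
Qed.

Lemma functional_of_surj (g : dualB V) : exists b, functional_of b = g.
Proof.
have psi_linear : linear psi.
  by move=> a c d; rewrite -[RHS]phiK phi_linear !psiK.
have psi_le c : bnorm (psi c) <= bnorm c by rewrite -phi_norm psiK.
pose G : contr (C0 k I) k^o := contr_comp g (contrS psi_linear psi_le).
exists (fun i => to_vint (val G (unitC0 k i))); apply: contr_eqP => v.
by rewrite -[in RHS](phiK v); exact: esym (contr_C0E G (phi v)).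
Qed.

(** The coordinates of [phi v] are values of contracting functionals at [v], so
    the norm of the evaluation at [v] is not smaller than the norm of [v]. *)
Lemma evalB_norm (v : V) : bnorm (val (evalB V) v) = bnorm v.
Proof.
apply: le_anti; rewrite contr_le -[leLHS]phi_norm /=.
apply: C0_norm_le => [|i]; first exact: bnorm_ge0.
rewrite -dot_delta.
exact: (supnorm_ub (functional_of (delta k i)) (dualM_bounded (evalB_fun v))).
Qed.

(** An element [F] of the double dual is a bounded functional on integral
    families, hence the pairing with a null family [c]; then [F] is the
    evaluation at the vector with coordinates [c]. *)
Lemma evalB_surj (k_nontrivial : nontrivially_valued k)
    (k_non_spherical : non_spherically_complete k) :
  ~ measurable_card I -> forall F, exists v, val (evalB V) v = F.
Proof.
move=> nI F.
have [||c Fc] := @functionalE _ _ k_nontrivial k_non_spherical I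
    (fun b => val F (functional_of b)) nI.
- by move=> s a b; rewrite functional_of_is_linear (dualM_linear F).
- by have [C FC] := dualM_bounded F; exists C => b; exact: FC.
exists (psi c); apply: dualM_eqP => g /=.
by have [b <-] := functional_of_surj g; rewrite Fc /= psiK.
Qed.

End FreeBanach.

Section CofreeModule.
Variables (R : realType) (k : completeValFieldType R).
Variables (I : choiceType) (M : lmodType (vint k)) (phi : M -> (I -> (vint k)^o)).
Hypothesis phi_linear : linear phi.

Fact null_functional_linear (c : C0 k I) : vint_linear (fun m => dot c (phi m) : k^o).
Proof. by move=> s m n; rewrite phi_linear dot_linearr. Qed.

Fact null_functional_bounded (c : C0 k I) :
  bounded_map (fun m => dot c (phi m) : k^o).
Proof. by have [C cC] := dot_bounded c; exists C => m; exact: cC. Qed.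

Definition null_functional c : dualM M :=
  dualMS (null_functional_linear c) (null_functional_bounded c).

Lemma null_functional_is_linear : linear null_functional.
Proof. by move=> s c d; apply: dualM_eqP => m /=; exact: dot_linearl. Qed.

Variable psi : (I -> (vint k)^o) -> M.
Hypotheses (phiK : cancel phi psi) (psiK : cancel psi phi).

Lemma null_functional_norm c : bnorm (null_functional c) = bnorm c.
Proof.
apply: le_anti; apply/andP; split.
  apply: supnorm_le (bnorm_ge0 _) _ => m /=.
  by apply: dot_le (bnorm_ge0 _) _ => i; exact: C0_coord_le.
apply: C0_norm_le => [|i]; first exact: bnorm_ge0.
rewrite -dot_delta -(psiK (delta k i)).
exact: (supnorm_ub (psi (delta k i)) (dualM_bounded (null_functional c))).
Qed.

Lemma evalM_inj : injective (val (evalM M)).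
Proof.
move=> m n mn; rewrite -(phiK m) -(phiK n); congr psi.
apply/funext => i; apply: val_inj; rewrite -!dot_unitC0.
exact: (congr1 (fun G : dualB (dualM M : banachType k) =>
  val G (null_functional (unitC0 k i))) mn).
Qed.

Hypothesis k_nontrivial : nontrivially_valued k.
Hypothesis k_non_spherical : non_spherically_complete k.
Hypothesis nI : ~ measurable_card I.

Lemma null_functional_surj (F : dualM M) : exists c, null_functional c = F.
Proof.
have psi_linear : linear psi.
  by move=> s a b; rewrite -[RHS]phiK phi_linear !psiK.
have [||c Fc] := @functionalE _ _ k_nontrivial k_non_spherical I
    (fun b => val F (psi b)) nI.
- by move=> s a b; rewrite psi_linear (dualM_linear F).
- by have [C FC] := dualM_bounded F; exists C => b; exact: FC.
by exists c; apply: dualM_eqP => m /=; rewrite -Fc phiK.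
Qed.

(** As every element of the dual comes from a null family, [G] is a contracting
    functional on [C0 k I], hence the pairing with an integral family. *)
Lemma evalM_surj (G : dualB (dualM M : banachType k)) : exists m, val (evalM M) m = G.
Proof.
have nfc c : bnorm (null_functional c) <= bnorm c by rewrite null_functional_norm.
pose G' : contr (C0 k I) k^o := contr_comp G (contrS null_functional_is_linear nfc).
exists (psi (fun i => to_vint (val G' (unitC0 k i)))); apply: contr_eqP => F /=.
have [c <-] := null_functional_surj F.
by rewrite /= psiK; exact: esym (contr_C0E G' c).
Qed.

End CofreeModule.

(** * The duality *)

Section Duality.
Variables (R : realType) (k : completeValFieldType R).
Hypothesis k_nontrivial : nontrivially_valued k.
Hypothesis k_non_spherical : non_spherically_complete k.

(** Finite subsets of the index set are needed for summation, and they require a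
    choice structure; any type has one classically. *)
Lemma free_banach_choice (V : banachType k) : free_banach V ->
  exists (I : choiceType) (phi : V -> C0 k I) (psi : C0 k I -> V),
    [/\ ~ measurable_card I, linear phi, forall v, bnorm (phi v) = bnorm v,
        cancel phi psi & cancel psi phi].
Proof.
by move=> [I [nI [phi [pl [psi pK qK] pn]]]]; exists {classic I}, phi, psi.
Qed.

Lemma cofree_choice (M : lmodType (vint k)) : cofree M ->
  exists (I : choiceType) (phi : M -> (I -> (vint k)^o)) (psi : (I -> (vint k)^o) -> M),
    [/\ ~ measurable_card I, linear phi, cancel phi psi & cancel psi phi].
Proof.
by move=> [I [nI [phi [pl [psi pK qK]]]]]; exists {classic I}, phi, psi.
Qed.

Lemma dualB_is_cofree (V : banachType k) : free_banach V -> cofree (dualB V).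
Proof.
move=> /free_banach_choice[I [phi [psi [nI pl pn pK qK]]]].
have [g [gl gK Kg]] := linear_inverse (functional_of_is_linear pl pn)
  (functional_of_inj qK) (functional_of_surj pl pn pK qK).
exists I; split=> //; exists g; split=> //.
by exists (functional_of pl pn).
Qed.

Lemma dualM_is_free (M : lmodType (vint k)) :
  cofree M -> free_banach (dualM M : banachType k).
Proof.
move=> /cofree_choice[I [phi [psi [nI pl pK qK]]]].
have [g [gl gn gK Kg]] := isometry_inverse (null_functional_is_linear pl)
  (null_functional_norm pl qK)
  (null_functional_surj pl pK qK k_nontrivial k_non_spherical nI).
exists I; split=> //; exists g; split=> //.
by exists (null_functional pl).
Qed.

Lemma evalB_isomorphism (V : banachType k) : free_banach V ->
  isomorphism (C := banCat k) (evalB V).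
Proof.
move=> /free_banach_choice[I [phi [psi [nI pl pn pK qK]]]].
apply: isometry_isomorphism; first exact: evalB_norm pl pn.
move=> F; exact: (evalB_surj pl pn pK qK k_nontrivial k_non_spherical nI F).
Qed.

Lemma evalM_isomorphism (M : lmodType (vint k)) : cofree M ->
  isomorphism (C := modCat (vint k)) (evalM M).
Proof.
move=> /cofree_choice[I [phi [psi [nI pl pK qK]]]].
apply: bijective_isomorphism; first by move=> m n; exact: (evalM_inj pl pK).
move=> G; exact: (evalM_surj pl pK qK k_nontrivial k_non_spherical nI G).
Qed.

End Duality.

Theorem corollary4p4 (R : realType) (k : completeValFieldType R)
    (k_nontrivial : nontrivially_valued k)
    (k_non_spherical : non_spherically_complete k) :
  exists (dualB_cofree : forall V : ob (banCat k),
            free_banach V -> cofree (cfun_ob (dualBFun k) V))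
         (dualM_free : forall M : ob (modCat (vint k)),
            cofree M -> free_banach (cfun_ob (dualMFun k) M)),
    contra_equivalence
      (contraRestrict dualB_cofree : contraFun
         (fullSubcat (C := banCat k) (@free_banach R k))
         (fullSubcat (C := modCat (vint k)) (@cofree R k)))
      (contraRestrict dualM_free : contraFun
         (fullSubcat (C := modCat (vint k)) (@cofree R k))
         (fullSubcat (C := banCat k) (@free_banach R k))).
Proof.
exists (@dualB_is_cofree R k), (@dualM_is_free R k k_nontrivial k_non_spherical).
split.
- exists (fun V => evalB (sval V)); split=> [V W f|V].
    by apply: contr_eqP => v; apply: dualM_eqP => g.
  exact: (evalB_isomorphism k_nontrivial k_non_spherical (svalP V)).
- exists (fun M => evalM (sval M)); split=> [M N f|M].
    by apply: mhom_eqP => m; apply: contr_eqP => F.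
  exact: (evalM_isomorphism k_nontrivial k_non_spherical (svalP M)).
Qed.
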